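(* For every pair of integers $k, g\geq 0$, there exists a non-zero integer $m = m(g,k)$ (depending only on $g$ and $k$) which annihilates the torsion subgroup of $\mathrm{MH}^{k}_{*}(G;\mathbb{Z})=\bigoplus_{l\ge 0}\mathrm{MH}^{k}_{l}(G;\mathbb{Z})$, for each graph $G$ of genus at most $g$.
   Context: Graphs. A graph $G$ is a finite, non-empty, connected, undirected graph with vertex set $V(G)$ and edge set $E(G)$; loops and multiple edges are allowed. Its (combinatorial) genus is $|E(G)|-|V(G)|+1$. $d_G$ denotes the shortest path metric on $V(G)$ (each edge has length $1$). Magnitude (co)homology. Let $R$ be a commutative ring with identity. For vertices $v_0,\dots,v_k$ with $v_i\ne v_{i+1}$ for all $i$, the length is $\ell(v_0,\dots,v_k)=\sum_{i=0}^{k-1}d_G(v_i,v_{i+1})$. For $k,l\in\mathbb{N}$, $\mathrm{MC}_{k,l}(G;R)$ is the free $R$-module on the tuples $(v_0,\dots,v_k)\in V(G)^{k+1}$ with $v_i\neq v_{i+1}$ for all $i$ and $\ell(v_0,\dots,v_k)=l$. The differential $\partial\colon \mathrm{MC}_{k,l}(G;R)\to \mathrm{MC}_{k-1,l}(G;R)$ is $\partial=\sum_{i=1}^{k-1}(-1)^i\partial_i$, where $\partial_i(v_0,\dots,v_k)=(v_0,\dots,v_{i-1},v_{i+1},\dots,v_k)$ if the latter tuple still has length $l$, and $\partial_i(v_0,\dots,v_k)=0$ otherwise. For fixed $l$ this is a chain complex. The magnitude cohomology $\mathrm{MH}^k_l(G;R)$ is the degree-$k$ cohomology of the dual complex $\mathrm{MC}^k_l(G;R)=\mathrm{Hom}_R(\mathrm{MC}_{k,l}(G;R),R)$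 with the dual differential. *)

(* Defs.v *)
From HB Require Import structures.
From mathcomp Require Import all_boot all_order all_algebra.
From mathcomp Require Import boolp.

Set Implicit Arguments.
Unset Strict Implicit.
Unset Printing Implicit Defensive.

Import GRing.Theory.
Local Open Scope ring_scope.

Section Adjacency.
Variables (V E : finType) (ends : E -> V * V).

Definition adjacent : rel V :=
  fun u v => [exists e, (ends e == (u, v)) || (ends e == (v, u))].

End Adjacency.

(* Edges are undirected: [ends e] lists the two endpoints of [e] in an
   arbitrary order, which plays no role below.  Distinct edges may have the
   same endpoints, and [ends e = (v, v)] is a loop at [v]. *)
Record graph := Graph {
  vertex : finType;
  edge : finType;
  ends : edge -> vertex * vertex;
  graph_nonempty : (0 < #|vertex|)%N;
  graph_connected : forall u v, connect (adjacent ends) u v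
}.

(* Integer-valued, so that no subtraction is truncated. *)
Definition genus (G : graph) : int := #|edge G|%:Z - #|vertex G|%:Z + 1.

Section Distance.
Variable G : graph.

Definition walk (u v : vertex G) (n : nat) : bool :=
  [exists p : n.-tuple (vertex G),
     path (adjacent (@ends G)) u p && (last u p == v)].

Lemma walk_exists u v : exists n, walk u v n.
Proof.
have /connectP[p pp vE] := graph_connected u v.
by exists (size p); apply/existsP; exists (in_tuple p); rewrite pp vE eqxx.
Qed.

Definition dist u v : nat := ex_minn (walk_exists u v).

End Distance.

Section MagnitudeTuples.
Variable G : graph.

Definition tlength k (v : k.+1.-tuple (vertex G)) : nat :=
  (\sum_(i < k) dist (tnth v (widen_ord (leqnSn k) i)) (tnth v (lift ord0 i)))%N.

Definition generator k l (v : k.+1.-tuple (vertex G)) : bool :=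
  [forall i : 'I_k,
     tnth v (widen_ord (leqnSn k) i) != tnth v (lift ord0 i)]
  && (tlength v == l).

Definition mtuple k l := {v : k.+1.-tuple (vertex G) | generator l v}.

Definition del k (i : 'I_k.+2) (v : k.+2.-tuple (vertex G)) :
  k.+1.-tuple (vertex G) := [tuple tnth v (lift i j) | j < k.+1].

End MagnitudeTuples.

Section MagnitudeComplex.
Variables (G : graph) (R : comNzRingType).

Definition MC k l : vectType R := {ffun mtuple G k l -> R^o}.

Definition mc_basis k l (v : mtuple G k l) : MC k l := [ffun w => (w == v)%:R].

(* [insub] also tests that consecutive vertices differ, but for an inner face
   this follows from the length being unchanged: if the neighbours of the
   deleted vertex coincide, then deleting it strictly decreases the length. *)
Definition face k l (i : 'I_k.+2) (v : mtuple G k.+1 l) : MC k l :=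
  if insub (del i (val v)) is Some w then mc_basis w else 0.

Definition boundary_fun k l (c : MC k.+1 l) : MC k l :=
  \sum_(v : mtuple G k.+1 l)
    (c : {ffun mtuple G k.+1 l -> R^o}) v *:
      \sum_(i < k.+2 | (0 < i < k.+1)%N) (-1) ^+ i *: face i v.

Lemma boundary_is_linear k l : linear (@boundary_fun k l).
Proof.
move=> a c c'; rewrite /boundary_fun scaler_sumr -big_split /=.
by apply: eq_bigr => v _; rewrite !ffunE scalerDl scalerA.
Qed.

HB.instance Definition _ k l := GRing.isLinear.Build R (MC k.+1 l) (MC k l) _
  (@boundary_fun k l) (@boundary_is_linear k l).

Definition boundary k l : 'Hom(MC k.+1 l, MC k l) := linfun (@boundary_fun k l).

Definition coMC k l : vectType R := 'Hom(MC k l, R^o).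

Definition coboundary k l (phi : coMC k l) : coMC k.+1 l :=
  (phi \o boundary k l)%VF.

Lemma coboundary_is_zmod_morphism k l : zmod_morphism (@coboundary k l).
Proof. by move=> f g; rewrite /coboundary comp_lfunDl comp_lfunNl. Qed.

HB.instance Definition _ k l :=
  GRing.isZmodMorphism.Build (coMC k l) (coMC k.+1 l)
    (@coboundary k l) (@coboundary_is_zmod_morphism k l).

(* The differential arriving in degree [k]; the complex vanishes in degree -1,
   so that the differential arriving in degree 0 is zero. *)
Definition coboundary_in k l : {additive coMC k.-1 l -> coMC k l} :=
  if k is k'.+1 then @coboundary k' l : {additive _ -> _} else \0.

End MagnitudeComplex.

Section Cohomology.
Variables (A B C : zmodType) (f : {additive A -> B}) (g : {additive B -> C}).

Definition ker_pred : {pred B} := fun x => g x == 0.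

Lemma ker_zmod_closed : zmod_closed ker_pred.
Proof.
split=> [|x y]; rewrite !unfold_in ?raddf0 ?eqxx // => /eqP gx /eqP gy.
by rewrite raddfB gx gy subrr.
Qed.

HB.instance Definition _ := GRing.isZmodClosed.Build B ker_pred ker_zmod_closed.

Record cocycles := Cocycle {
  cocycle_val :> B; cocycleP : cocycle_val \in ker_pred }.

HB.instance Definition _ := [isSub for cocycle_val].
HB.instance Definition _ := [Choice of cocycles by <:].
HB.instance Definition _ := [SubChoice_isSubZmodule of cocycles by <:].

(* Cocycles of the form [f a]; this is all of the image of [f] when
   [g \o f = 0]. *)
Definition coboundaries : {pred cocycles} :=
  fun z => `[< exists a, f a = val z >].

Lemma coboundaries_zmod_closed : zmod_closed coboundaries.
Proof.
split=> [|x y].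
  by apply/asboolP; exists 0; rewrite !raddf0.
move=> /asboolP[a fa] /asboolP[b fb].
by apply/asboolP; exists (a - b); rewrite !raddfB /= fa fb.
Qed.

HB.instance Definition _ :=
  GRing.isZmodClosed.Build cocycles coboundaries coboundaries_zmod_closed.

Definition cohomology : zmodType := Quotient.quot coboundaries.

End Cohomology.

Definition MH (G : graph) (R : comNzRingType) (k l : nat) : zmodType :=
  cohomology (coboundary_in G R k l) (@coboundary G R k l : {additive _ -> _}).

Section DirectSum.
Variable M : nat -> zmodType.

Definition dprod := forall l, M l.

HB.instance Definition _ := Choice.copy dprod (forall l, M l).

Let dzero : dprod := fun=> 0.
Let dopp (x : dprod) : dprod := fun l => - x l.
Let dadd (x y : dprod) : dprod := fun l => x l + y l.

Fact daddA : associative dadd.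
Proof. by move=> x y z; apply: functional_extensionality_dep => l; exact: addrA. Qed.
Fact daddC : commutative dadd.
Proof. by move=> x y; apply: functional_extensionality_dep => l; exact: addrC. Qed.
Fact dadd0 : left_id dzero dadd.
Proof. by move=> x; apply: functional_extensionality_dep => l; exact: add0r. Qed.
Fact daddN : left_inverse dzero dopp dadd.
Proof. by move=> x; apply: functional_extensionality_dep => l; exact: addNr. Qed.

HB.instance Definition _ := GRing.isZmodule.Build dprod daddA daddC dadd0 daddN.

Definition finitely_supported : {pred dprod} :=
  fun x => `[< exists N, forall l, (N <= l)%N -> x l = 0 >].

Lemma finitely_supported_zmod_closed : zmod_closed finitely_supported.
Proof.
split=> [|x y]; first by apply/asboolP; exists 0%N.
move=> /asboolP[a xa] /asboolP[b yb]; apply/asboolP; exists (maxn a b) => l.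
by rewrite geq_max => /andP[al bl]; rewrite -[LHS]/(x l - y l) xa ?yb ?subrr.
Qed.

HB.instance Definition _ :=
  GRing.isZmodClosed.Build dprod finitely_supported finitely_supported_zmod_closed.

Record dsum := DSum {
  dsum_val :> dprod; dsumP : dsum_val \in finitely_supported }.

HB.instance Definition _ := [isSub for dsum_val].
HB.instance Definition _ := [Choice of dsum by <:].
HB.instance Definition _ := [SubChoice_isSubZmodule of dsum by <:].

End DirectSum.

Definition MHtotal (G : graph) (R : comNzRingType) (k : nat) : zmodType :=
  dsum (MH G R k).

Definition torsion (M : zmodType) (x : M) : Prop :=
  exists n : int, n != 0 /\ x *~ n = 0.

(* Main.v *)
(* The complex splits by the first vertex [b] of a tuple, and the tuples starting at [b]
   compute [Ext] over the graded path algebra of [G] (generators the pairs (x, y), with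
   (x, y)(y, z) = (x, z) when [y] lies on a geodesic from [x] to [z], and 0 otherwise).

   A leaf is never an inner deletable vertex, so the tuples through it form a direct
   summand, whose cohomology has torsion of exponent bounded in terms of [k] by an explicit
   homotopy; hence leaves can be pruned.  In a leafless graph of genus at most [g] all but
   a bounded number of vertices [x] have exactly two neighbours, one closer to a given [c]
   and one farther.  Away from these exceptional vertices a kernel of free modules is
   transported from the neighbours and needs no new generators, so one obtains free
   resolutions whose first [k] terms have bounded rank and whose matrices have bounded
   entries.  Only finitely many integer matrices then occur, and the torsion of each has
   some finite exponent. *)
Require Import Defs.
From HB Require Import structures.
From mathcomp Require Import all_boot all_order all_algebra.
From mathcomp Require Import boolp zify ring.

Set Implicit Arguments.
Unset Strict Implicit.
Unset Printing Implicit Defensive.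

Import Order.TTheory GRing.Theory Num.Theory.
Local Open Scope ring_scope.

(** * Cochains on sequences *)

(** [sorted] compares only consecutive entries, so repetitions at a distance remain allowed. *)
Definition nd (T : eqType) (s : seq T) := sorted (fun x y => x != y) s.
Arguments nd : simpl never.

Section Cochains.
Variables (T : eqType) (d : T -> T -> nat).

Definition btw x y z := (d x y + d y z == d x z)%N.

(* Minus the dual differential, as its first term deletes the vertex of index 1. *)
Fixpoint delta (f : seq T -> int) (s : seq T) : int :=
  if s is x :: s1 then
    if s1 is y :: z :: s2 then
      (btw x y z)%:R * f [:: x, z & s2] - delta (fun u => f (x :: u)) s1
    else 0
  else 0.

Lemma deltaE f x y z s : delta f [:: x, y, z & s] =
  (btw x y z)%:R * f [:: x, z & s] - delta (fun u => f (x :: u)) [:: y, z & s].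
Proof. by []. Qed.

Lemma delta_short f s : (size s <= 2)%N -> delta f s = 0.
Proof. by case: s => [|x [|y [|z s]]]. Qed.

Arguments delta : simpl never.

(** The hypothesis ranges over exactly the faces that contribute to [delta]; conditions on
    non-degeneracy, length or support enter later computations through it. *)
Lemma delta_ext f f' s :
  (forall p x y z q, s = p ++ [:: x, y, z & q] -> btw x y z ->
     f (p ++ [:: x, z & q]) = f' (p ++ [:: x, z & q])) ->
  delta f s = delta f' s.
Proof.
elim: s f f' => [|x [|y [|z s]] IH] f f' ff'; try by rewrite !delta_short.
rewrite !deltaE; congr (_ - _).
  case: (boolP (btw x y z)) => [b|_]; last by rewrite !mul0r.
  by rewrite (ff' [::] x y z s).
apply: IH => p x' y' z' q E b; exact: (ff' (x :: p) x' y' z' q (congr1 (cons x) E) b).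
Qed.

Lemma eq_delta f f' s : f =1 f' -> delta f s = delta f' s.
Proof. by move=> ff'; apply: delta_ext. Qed.

(** The first vertex is never deleted, so a dependence on it can be frozen. *)
Lemma delta_head (F : T -> seq T -> int) x0 x s :
  delta (fun u => F (head x0 u) u) (x :: s) = delta (F x) (x :: s).
Proof. by apply: delta_ext => -[|y p] x' y' z' q [-> _]. Qed.

Lemma delta_sum (I : finType) (a : I -> int) (f : I -> seq T -> int) s :
  delta (fun u => \sum_i a i * f i u) s = \sum_i a i * delta (f i) s.
Proof.
elim: s f => [|x [|y [|z s]] IH] f.
1-3: by rewrite delta_short // big1 // => i _; rewrite delta_short // mulr0.
rewrite deltaE (IH (fun i u => f i (x :: u))) mulr_sumr -sumrB.
by apply: eq_bigr => i _; rewrite deltaE; ring.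
Qed.

Lemma deltaZ a f s : delta (fun u => a * f u) s = a * delta f s.
Proof.
have := delta_sum (fun _ : 'I_1 => a) (fun _ => f) s.
by rewrite big_ord1 => <-; apply: eq_delta => u; rewrite big_ord1.
Qed.

Lemma deltaB f f' s : delta (fun u => f u - f' u) s = delta f s - delta f' s.
Proof.
have := delta_sum (fun b : bool => if b then 1 else -1)
  (fun b => if b then f else f') s.
rewrite big_bool /= !mul1r !mulN1r => <-.
by apply: eq_delta => u; rewrite big_bool /= mul1r mulN1r.
Qed.

Lemma delta0 s : delta (fun=> 0) s = 0.
Proof. by rewrite (eq_delta (f' := fun u => 0 * 0)) ?deltaZ ?mul0r // => u; rewrite mul0r. Qed.

Hypothesis dtri : forall x y z, (d x z <= d x y + d y z)%N.

(** Both sides say that the three steps add up to [d x w]; this is associativity of the path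
    algebra. *)
Lemma btw4 x y z w : btw x y z && btw x z w = btw y z w && btw x y w.
Proof.
rewrite /btw; have := dtri x y z; have := dtri x z w.
have := dtri y z w; have := dtri x y w; lia.
Qed.

Let dbl f x t : int :=
  if t is [:: y, z & r] then (btw x y z)%:R * f [:: x, z & r] else 0.

Let delta_cons f x t : delta f (x :: t) = dbl f x t - delta (fun u => f (x :: u)) t.
Proof. by case: t => [|y [|z r]]; rewrite ?deltaE // !delta_short // subr0. Qed.

(** After the first vertex is peeled off, induction handles pairs of deletions behind the first
    inner vertex. Of the rest, the deletions of the first two inner vertices cancel by [btw4], all
    others by sign. *)
Lemma delta_delta f s : delta (delta f) s = 0.
Proof.
elim: s f => [|x [|y [|z r]] IH] f; try by rewrite delta_short.
rewrite delta_cons [dbl _ _ _]/=.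
rewrite (eq_delta (f := fun u => delta f (x :: u)) (f' := fun t => dbl f x t - delta (fun u => f (x :: u)) t)); last first.
  by move=> t; exact: delta_cons.
rewrite deltaB IH subr0.
case: r IH => [|w r] IH; first by rewrite /= mulr0 !subr0.
rewrite (delta_cons f) (delta_cons (dbl f x)) /=.
have -> : delta (fun u => dbl f x (y :: u)) [:: z, w & r]
   = (btw x y z)%:R * delta (fun u => f (x :: u)) [:: z, w & r].
  rewrite (_ : delta _ _ = delta (fun u => (btw x y (head z u))%:R * f (x :: u)) [:: z, w & r]).
    by rewrite (delta_head (fun a u => (btw x y a)%:R * f (x :: u))) deltaZ.
  by apply: delta_ext => -[|? p] x' y' z' q.
rewrite mulrBr !mulrA -!natrM !mulnb btw4; ring.
Qed.

Lemma delta_supp f s :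
  (forall p x y z q, s = p ++ [:: x, y, z & q] -> ~~ btw x y z) -> delta f s = 0.
Proof.
by move=> H; rewrite -(delta0 s); apply: delta_ext => p x y z q /H /negPf ->.
Qed.

End Cochains.

Arguments delta : simpl never.

(** * Integer matrices *)

(** A kernel in [Z^m] is a direct summand because the quotient by it is torsion-free. In Smith
    normal form the projection is the mask [w] of the coordinates without a non-zero diagonal
    entry. *)
Lemma int_kermx_proj m n (N : 'M[int]_(m, n)) :
  exists E : 'M[int]_m, E *m N = 0 /\ forall u : 'rV_m, u *m N = 0 -> u *m E = u.
Proof.
have [L Lu [R Ru [e _ ->]]] := int_Smith_normal_form N.
set D : 'M[int]_(m, n) := \matrix_(i, j) _.
pose w : 'rV[int]_m := \row_i ((n <= i)%N || (e`_i == 0))%:R.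
have wD : diag_mx w *m D = 0.
  apply/matrixP => i j; rewrite mul_diag_mx !mxE.
  case: (eqVneq (i : nat) j) => [ij|_]; last by rewrite mulr0n mulr0.
  by rewrite ij leqNgt ltn_ord /=; case: eqP => [->|_]; rewrite ?mul0rn ?mulr0 ?mul0r.
exists (L *m diag_mx w *m invmx L); split.
  by rewrite !mulmxA mulmxKV // -(mulmxA L) wD mulmx0 mul0mx.
move=> u uN; have uLD : u *m L *m D = 0.
  by apply: (can_inj (mulmxK Ru)); rewrite mul0mx -uN !mulmxA.
suff uw : u *m L *m diag_mx w = u *m L by rewrite !mulmxA uw mulmxK.
apply/matrixP => a i; rewrite mul_mx_diag; move: (u *m L) uLD => v vD.
rewrite !mxE; case: leqP => [_|ni] /=; first by rewrite mulr1.
case: eqP => [_|/eqP ei]; first by rewrite mulr1.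
have /matrixP/(_ a (Ordinal ni)) := vD; rewrite !mxE (bigD1 i) //= big1 => [|k kNi].
  rewrite !mxE eqxx mulr1n addr0 => /eqP; rewrite mulf_eq0 (negPf ei) orbF => /eqP->.
  by rewrite mul0r.
by rewrite mxE /= (negPf (_ : (k != i :> nat))) ?mulr0n ?mulr0.
Qed.

(** [W] is a rational generalized inverse with denominators cleared; in Smith normal form it is
    diagonal. *)
Lemma int_mx_quasi_inverse m n (Q : 'M[int]_(m, n)) :
  exists2 c : nat, (0 < c)%N & exists W : 'M[int]_(n, m), Q *m W *m Q = c%:Z *: Q.
Proof.
have [L Lu [R Ru [e _ ->]]] := int_Smith_normal_form Q.
set D : 'M[int]_(m, n) := \matrix_(i, j) _.
pose a i : int := if e`_i == 0 then 1 else e`_i.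
have a0 i : a i != 0 by rewrite /a; case: (eqVneq e`_i 0).
pose c : int := \prod_(i < m) a i.
have [b ab] : exists b : 'I_m -> int, forall i, b i * a i = c ^+ 2.
  (* The product clears the denominator [a i]; the extra factor [c] makes the common value a square,
     hence positive. *)
  exists (fun i => (\prod_(j < m | j != i) a j) * c) => i.
  have cE : c = a i * \prod_(j < m | j != i) a j by rewrite /c (bigD1 i).
  by rewrite expr2 {2}cE; ring.
pose W : 'M[int]_(n, m) := \matrix_(j, i) (b i *+ (i == j :> nat)).
have DWD : D *m W *m D = c ^+ 2 *: D.
  have -> : D *m W = diag_mx (\row_i (((i < n)%N && (e`_i != 0))%:R * c ^+ 2)).
    apply/matrixP => i k; rewrite !mxE.
    case: (ltnP i n) => [ni|ni] /=.
      rewrite (bigD1 (Ordinal ni)) //= big1 => [|j ji]; last first.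
        rewrite !mxE (_ : (i == j :> nat) = false) ?mulr0n ?mul0r //.
        by apply: contraNF ji => /eqP ij; apply/eqP/val_inj.
      rewrite !mxE eqxx mulr1n addr0 eq_sym -val_eqE eq_sym /=.
      case: (eqVneq (i : nat) k) => [/val_inj <-|_]; last by rewrite !mulr0n mulr0.
      rewrite !mulr1n -(ab i) /a; case: (eqVneq e`_i 0) => [->|_] /=; ring.
    rewrite big1 => [|j _]; first by rewrite mul0r mul0rn.
    rewrite !mxE (_ : (i == j :> nat) = false) ?mulr0n ?mul0r //.
    by apply/negbTE; rewrite neq_ltn (leq_trans (ltn_ord j) ni) orbT.
  apply/matrixP => i j; rewrite mul_diag_mx !mxE.
  case: (eqVneq (i : nat) j) => [ij|_]; last by rewrite !mulr0n !mulr0.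
  by rewrite ij ltn_ord /=; case: eqP => [->|_] /=; ring.
exists `|c ^+ 2|%N; first by rewrite absz_gt0 expf_neq0 //; apply/prodf_neq0.
exists (invmx R *m W *m invmx L).
have -> : (`|c ^+ 2|%N%:Z = c ^+ 2) by rewrite abszE ger0_norm // sqr_ge0.
rewrite !mulmxA mulmxK // mulmxKV // -(mulmxA L) -(mulmxA L) DWD.
by rewrite -scalemxAr -scalemxAl.
Qed.

(** This finiteness is the source of the uniform constants: a choice made for each code in [I] can
    be combined over all of [I]. *)
Lemma bounded_matrices m n B :
  exists (I : finType) (dec : I -> 'M[int]_(m, n)), forall A : 'M[int]_(m, n),
    (forall i j, (`|A i j| <= B)%N) -> exists C, A = dec C.
Proof.
exists 'M['I_(B + B).+1]_(m, n), (map_mx (fun c : 'I_ _ => c%:Z - B%:Z)) => A AB.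
exists (map_mx (fun a : int => inord (absz (a + B%:Z))) A).
by apply/matrixP => i j; rewrite !mxE inordK; have := AB i j; lia.
Qed.

(** Rows of these projections become the matrix of the next cover, so their entries must stay
    bounded along the resolution. *)
Lemma kermx_proj_bounded m n B :
  exists B', forall N : 'M[int]_(m, n), (forall i j, (`|N i j| <= B)%N) ->
    exists E : 'M[int]_m, [/\ E *m N = 0, forall u : 'rV_m, u *m N = 0 -> u *m E = u
      & forall i j, (`|E i j| <= B')%N].
Proof.
have [I [dec decP]] := bounded_matrices m n B.
have [E EP] := choice (fun C => int_kermx_proj (dec C)).
exists (\max_C \max_i \max_j `|E C i j|)%N => N /decP[C ->].
exists (E C); have [EN EK] := EP C; split=> // i j.
apply: leq_trans (leq_bigmax C); apply: leq_trans (leq_bigmax i).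
exact: leq_bigmax.
Qed.

(* Functionals on the lattice [ker N] are column vectors of [Z^m] read modulo
   those vanishing on it; the claim bounds the torsion of the quotient by the
   functionals supported on [A], uniformly in [N]. *)
Lemma restricted_functionals_torsion m n B :
  exists2 c : nat, (0 < c)%N & forall (N : 'M[int]_(m, n)) (A : {set 'I_m}),
    (forall i j, (`|N i j| <= B)%N) ->
    forall (a : int) (y g : 'cV[int]_m), a != 0 ->
    (forall i, i \notin A -> g i 0 = 0) ->
    (forall u : 'rV_m, u *m N = 0 -> a *: (u *m y) = u *m g) ->
    exists2 h : 'cV[int]_m, (forall i, i \notin A -> h i 0 = 0) &
      forall u : 'rV_m, u *m N = 0 -> c%:Z *: (u *m y) = u *m h.
Proof.
have [I [dec decP]] := bounded_matrices m n B.
have [E EP] := choice (fun C => int_kermx_proj (dec C)).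
pose mask (A : {set 'I_m}) : 'M[int]_m := diag_mx (\row_i (i \in A)%:R).
have maskE A (g : 'cV[int]_m) i : (mask A *m g) i 0 = (i \in A)%:R * g i 0.
  by rewrite /mask mul_diag_mx !mxE.
pose Q C A := E C *m mask A.
have /choice[f fP] (p : I * {set 'I_m}) : exists f : nat * 'M[int]_m,
   (0 < f.1)%N /\ Q p.1 p.2 *m f.2 *m Q p.1 p.2 = f.1%:Z *: Q p.1 p.2.
  by have [c c0 [W WP]] := int_mx_quasi_inverse (Q p.1 p.2); exists (c, W).
exists (\prod_p (f p).1)%N; first by rewrite prodn_gt0 // => p; have [] := fP p.
move=> N A /decP[C {N}->] a y g a0 gA yg.
have [EN EK] := EP C; have [c0 cP] := fP (C, A); rewrite (bigD1 (C, A)) //= mulnC.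
move: (\prod_(_ | _) _)%N (f _) c0 cP => q [c W] /= c0 cP.
have gM : g = mask A *m g.
  apply/colP => i; rewrite maskE.
  by case: (boolP (i \in A)) => [_|/gA->]; rewrite ?mul1r ?mulr0.
have Ey : a *: (E C *m y) = Q C A *m g.
  apply/row_matrixP => i; rewrite linearZ /= !row_mul -mulmxA -gM.
  by apply: yg; rewrite -row_mul EN row0.
(* Since [a *: (E C *m y)] is [Q C A *m g] and [Q W Q = c Q], applying [Q W] to [E C *m y]
   multiplies it by [c], once [a] is cancelled. The factor [q] collects the constants of the other
   codes and supports. *)
exists (q%:Z *: (mask A *m (W *m (E C *m y)))).
  by move=> i /negbTE iA; rewrite mxE maskE iA mul0r mulr0.
move=> u uN; rewrite -scalemxAr PoszM -scalerA; congr (_ *: _).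
have yE : u *m y = u *m (E C *m y) by rewrite mulmxA EK.
have QE z : u *m (mask A *m z) = u *m (Q C A *m z) by rewrite /Q !mulmxA EK.
rewrite yE QE scalemxAr; congr (_ *m _).
have aI : injective (fun z : 'cV[int]_m => a *: z).
  by move=> z z' /colP zz'; apply/colP => i; have := zz' i; rewrite !mxE => /(mulfI a0).
apply: aI => /=.
rewrite [LHS]scalerA (mulrC a) -scalerA.
have -> : a *: (Q C A *m (W *m (E C *m y))) = Q C A *m (W *m (a *: (E C *m y))).
  by rewrite -!scalemxAr.
by rewrite Ey (mulmxA W) (mulmxA (Q C A)) (mulmxA (Q C A) W) cP -scalemxAl.
Qed.

(** * Dimension shift *)

Record metric (T : eqType) (d : T -> T -> nat) : Prop := Metric {
  dist_eq0 : forall x y, (d x y == 0%N) = (x == y);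
  dist_sym : forall x y, d x y = d y x;
  dist_tri : forall x y z, (d x z <= d x y + d y z)%N }.

Lemma delta_cons (T : eqType) (d : T -> T -> nat) f f' x s :
  (forall u, f (x :: u) = f' (x :: u)) -> delta d f (x :: s) = delta d f' (x :: s).
Proof. by move=> ff'; apply: delta_ext => -[|y p] x' y' z' q [<- _] _; apply: ff'. Qed.

Lemma nd_cons2 (T : eqType) (x y : T) s : nd [:: x, y & s] = (x != y) && nd (y :: s).
Proof. by []. Qed.

Section Metric.
Variables (T : eqType) (d : T -> T -> nat).
Hypothesis dM : metric d.

Lemma dist_xx x : d x x = 0%N.
Proof. by apply/eqP; rewrite (dist_eq0 dM). Qed.

Lemma btw_ends x y z : btw d x y z -> x != y -> x != z.
Proof.
move=> b xy; apply: contraTneq b => <-.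
by rewrite /btw dist_xx addn_eq0 negb_and (dist_eq0 dM) xy.
Qed.

Lemma btwxxy x y : btw d x x y.
Proof. by rewrite /btw dist_xx. Qed.

Lemma nd_del p x y z q : nd (p ++ [:: x, y, z & q]) -> btw d x y z ->
  nd (p ++ [:: x, z & q]).
Proof.
rewrite /nd => + b; elim: p => [|w p IH] /=.
  by move=> /and3P[xy _ ->]; rewrite (btw_ends b xy).
by case: p IH => [|w' p] IH /= /andP[-> /IH].
Qed.

Lemma delta_nd f f' s : nd s ->
  (forall u, nd u -> (size u).+1 = size s -> f u = f' u) ->
  delta d f s = delta d f' s.
Proof.
move=> nds ff'; apply: delta_ext => p x y z q E b; apply: ff'.
  by move: nds; rewrite E => /nd_del; apply.
by rewrite E !size_cat /= !addnS.
Qed.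

(** * Cochains with values in modules *)

Section Module.
Variables (J : nat) (c : 'I_J -> T).
Implicit Types f : 'I_J -> seq T -> int.

(* Cochains with values in the free module on generators placed at the [c j]: the generator
   [j] acts as an extra first vertex, which is allowed to equal the second one. *)
Definition mdelta f j (s : seq T) : int := delta d (fun u => f j (behead u)) (c j :: s).

Definition pairing (u : 'rV[int]_J) f s : int := \sum_j u 0 j * f j s.

Lemma mdelta1 f j x : mdelta f j [:: x] = 0.
Proof. by []. Qed.

(** Behind the generator [c j] the vertex [x] is an inner one; the first term deletes it and encodes
    the action on the generator. *)
Lemma mdelta2 f j x y t : mdelta f j [:: x, y & t] =
  (btw d (c j) x y)%:R * f j (y :: t) - delta d (f j) [:: x, y & t].
Proof. by []. Qed.

Lemma mdelta_nd f f' j s : nd s ->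
  (forall u, nd u -> (size u).+1 = size s -> f j u = f' j u) ->
  mdelta f j s = mdelta f' j s.
Proof.
case: s => [|x [|y t]] // nds ff'; rewrite !mdelta2; congr (_ * _ - _).
  by apply: ff' => //; move: nds; rewrite nd_cons2 => /andP[].
exact: delta_nd.
Qed.

Lemma mdelta_mdelta f j s : mdelta (mdelta f) j s = 0.
Proof.
rewrite /mdelta (delta_cons _ (f' := delta d (fun u => f j (behead u)))) //.
exact: delta_delta (dist_tri dM) _ _.
Qed.

Lemma mdeltaZB a f f' j s :
  mdelta (fun j u => a * f j u - f' j u) j s = a * mdelta f j s - mdelta f' j s.
Proof. by rewrite /mdelta deltaB deltaZ. Qed.

Lemma pairingZB u a f f' s :
  pairing u (fun j t => a * f j t - f' j t) s = a * pairing u f s - pairing u f' s.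
Proof. by rewrite /pairing mulr_sumr -sumrB; apply: eq_bigr => j _; ring. Qed.

Lemma eq_pairing u f f' s s' : (forall j, f j s = f' j s') -> pairing u f s = pairing u f' s'.
Proof. by move=> ff'; apply: eq_bigr => j _; rewrite ff'. Qed.

Lemma pairingBl u v f s : pairing (u - v) f s = pairing u f s - pairing v f s.
Proof. by rewrite /pairing -sumrB; apply: eq_bigr => j _; rewrite !mxE; ring. Qed.

Lemma pairing_mul I (p : 'rV_I) (A : 'M_(I, J)) f s :
  pairing (p *m A) f s = \sum_i p 0 i * pairing (row i A) f s.
Proof.
rewrite /pairing; under [RHS]eq_bigr => i _ do rewrite mulr_sumr.
rewrite exchange_big /=; apply: eq_bigr => j _; rewrite !mxE mulr_suml.
by apply: eq_bigr => i _; rewrite !mxE mulrA.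
Qed.

Lemma pairing_delta u f j : pairing (delta_mx 0 j) f u = f j u.
Proof.
rewrite /pairing (bigD1 j) //= big1 => [|i ij]; rewrite mxE eqxx /=.
  by rewrite eqxx mul1r addr0.
by rewrite (negPf ij) mul0r.
Qed.

(* A cocycle of positive degree with values in a free module is the coboundary
   of its cone. *)
Definition cone f j s : int :=
  if s is x :: _ then if x == c j then 0 else f j (c j :: s) else 0.

(** The cocycle equation at the tuple extended by [c j] expresses [f] through its values on tuples
    starting at [c j]. If [x] is [c j] already, only the term deleting [x] survives. *)
Lemma mdelta_cone f j x y t : nd [:: x, y & t] ->
  (x != c j -> mdelta f j [:: c j, x, y & t] = 0) ->
  mdelta (cone f) j [:: x, y & t] = f j [:: x, y & t].
Proof.
rewrite nd_cons2 => /andP[xy _]; rewrite !mdelta2 btwxxy mul1r.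
case: (eqVneq x (c j)) => [xc _|xc /(_ isT)/eqP].
  rewrite -xc btwxxy mul1r /= -xc eq_sym (negPf xy).
  rewrite [X in _ - X](delta_cons _ (f' := fun=> 0)) ?delta0 ?subr0 // => u /=.
  by rewrite xc eqxx.
rewrite subr_eq0 => /eqP->; rewrite deltaE; congr (_ - _).
  case: (boolP (btw d (c j) x y)) => [b|]; last by rewrite !mul0r.
  by rewrite /= eq_sym (negPf (btw_ends b _)) // eq_sym.
by apply: delta_cons => u /=; rewrite (negPf xc).
Qed.

Variables (J' : nat) (N : T -> 'M[int]_(J, J')).

(* The module is [ker (N x)] at [x]; its cochains are represented, not uniquely, by cochains
   of the ambient free module. *)
Definition torsion_bound K (m : nat) := forall f psi (n : int), n != 0 ->
  (forall x t u, nd (x :: t) -> size t = K.+1 -> u *m N x = 0 ->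
     pairing u (mdelta f) (x :: t) = 0) ->
  (forall x t u, nd (x :: t) -> size t = K -> u *m N x = 0 ->
     n * pairing u f (x :: t) = pairing u (mdelta psi) (x :: t)) ->
  exists psi', forall x t u, nd (x :: t) -> size t = K -> u *m N x = 0 ->
     m%:Z * pairing u f (x :: t) = pairing u (mdelta psi') (x :: t).

End Module.
End Metric.

(** * Covers by free modules *)

Section Shift.
Variables (T : eqType) (d : T -> T -> nat).
Hypothesis dM : metric d.
Variables (J J' : nat) (c : 'I_J -> T) (N : T -> 'M[int]_(J, J')).
Variables (I : nat) (e : 'I_I -> T) (F : 'M[int]_(I, J)).

(* The map from the free module on generators at the [e i] sending the generator [i] to the
   element [row i F] of the module at [e i]. *)
Definition cover x : 'M[int]_(I, J) := \matrix_(i, j) (F i j *+ btw d (c j) (e i) x).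

Hypothesis act : forall x y (u : 'rV_J), u *m N x = 0 ->
  (\row_j (u 0 j *+ btw d (c j) x y)) *m N y = 0.
Hypothesis FN : forall i, row i F *m N (e i) = 0.
(** A section of the cover, chosen at each vertex separately; it need not respect the action. *)
Variable S : T -> 'M[int]_(J, I).
Hypothesis SP : forall x (u : 'rV_J), u *m N x = 0 -> u *m S x *m cover x = u.

Lemma cover_ker x : cover x *m N x = 0.
Proof.
apply/row_matrixP => i; rewrite row_mul row0 -[RHS](act x (FN i)).
by congr (_ *m _); apply/rowP => j; rewrite !mxE.
Qed.

Lemma coverS (p : 'rV_I) x : p *m cover x *m S x *m cover x = p *m cover x.
Proof. by rewrite SP // -mulmxA cover_ker mulmx0. Qed.

Definition pull (f : 'I_J -> seq T -> int) (i : 'I_I) (s : seq T) : int :=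
  if s is x :: _ then pairing (row i (cover x)) f s else 0.

Lemma pairing_pull (p : 'rV_I) f x t : pairing p (pull f) (x :: t) = pairing (p *m cover x) f (x :: t).
Proof. by rewrite pairing_mul. Qed.

(** The cover commutes with the action: for each [i] and [j] this is [btw4]. *)
Lemma mdelta_pull f i x t :
  mdelta d e (pull f) i (x :: t) = pull (mdelta d c f) i (x :: t).
Proof.
case: t => [|y t]; first by rewrite mdelta1 /= /pairing big1 // => j _; rewrite mdelta1 mulr0.
rewrite mdelta2 /= /pairing.
rewrite (delta_cons _ _ (f' := fun u => \sum_j row i (cover x) 0 j * f j u)) //.
rewrite delta_sum mulr_sumr -sumrB; apply: eq_bigr => j _; rewrite mdelta2 !mxE.
rewrite -!(mulr_natr (F i j)) mulrBr; congr (_ - _).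
have := btw4 (dist_tri dM) (c j) (e i) x y.
by do 4![case: (btw d _ _ _)] => //= _; ring.
Qed.

Lemma pull_act f K : (forall x t (u : 'rV_J), nd (x :: t) -> size t = K -> u *m N x = 0 ->
     pairing u f (x :: t) = 0) ->
  forall i x t, nd (x :: t) -> size t = K -> pull f i (x :: t) = 0.
Proof. by move=> f0 i x t ndt st; apply: f0; rewrite // -row_mul cover_ker row0. Qed.

(** A cochain [h] that kills the kernel of the cover factors through the module: composed with the
    section [S] it gives [psi] with [pull psi = h]. Since the cover is onto, the identity for [h]
    descends to [psi]. *)
Lemma descend K (m : nat) f h :
  (forall x t (p : 'rV_I), nd (x :: t) -> size t = K -> p *m cover x = 0 -> pairing p h (x :: t) = 0) ->
  (forall i x t, nd (x :: t) -> size t = K.+1 ->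
     m%:Z * pull f i (x :: t) = mdelta d e h i (x :: t)) ->
  exists psi, forall x t (u : 'rV_J), nd (x :: t) -> size t = K.+1 -> u *m N x = 0 ->
     m%:Z * pairing u f (x :: t) = pairing u (mdelta d c psi) (x :: t).
Proof.
move=> h0 hf; exists (fun j s => if s is x :: _ then pairing (row j (S x)) h s else 0).
set psi := (fun j s => _) => x t u ndt st uN.
have psiE i y r : nd (y :: r) -> size r = K -> pull psi i (y :: r) = h i (y :: r).
  move=> ndr sr; rewrite /= -[RHS]pairing_delta.
  transitivity (pairing (row i (cover y) *m S y) h (y :: r)); first by rewrite pairing_mul.
  rewrite rowE; apply/eqP; rewrite -subr_eq0 -pairingBl h0 //.
  by rewrite mulmxBl coverS subrr.
rewrite -(SP uN) -!pairing_pull /pairing mulr_sumr; apply: eq_bigr => i _.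
rewrite mulrCA hf // -mdelta_pull; congr (_ * _); apply: mdelta_nd => // -[|y r] //.
  by case: t st {ndt}.
by move=> ndr [sr]; apply/esym/psiE => //; move: sr; rewrite st => -[].
Qed.

(* Dimension shift: [pull f] is the coboundary of its cone, whose restriction
   to the kernel of the cover is a torsion cocycle of one degree less. *)
Lemma torsion_bound_shift K m : torsion_bound d e cover K.+1 m ->
  torsion_bound d c N K.+2 m.
Proof.
move=> IH f psi n n0 fZ fT; pose chi := cone e (pull f).
have fZ' i x t : nd (x :: t) -> size t = K.+3 -> mdelta d e (pull f) i (x :: t) = 0.
  by rewrite mdelta_pull; apply: pull_act.
have chiE i x t : nd (x :: t) -> size t = K.+2 ->
    mdelta d e chi i (x :: t) = pull f i (x :: t).
  case: t => [|y t] // ndt [st]; apply: mdelta_cone => // xe.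
  by apply: fZ'; rewrite ?nd_cons2 1?eq_sym ?xe //= st.
(* Both terms have coboundary [n * pull f], so [g] is a cocycle and hence the coboundary of its
   cone. On the kernel of the cover [pull psi] vanishes, so there [n * chi] is itself a
   coboundary. *)
pose g i s := n * chi i s - pull psi i s.
have gZ i x t : nd (x :: t) -> size t = K.+2 -> mdelta d e g i (x :: t) = 0.
  move=> ndt st; rewrite mdeltaZB chiE // mdelta_pull /= -fT ?subrr //.
  by rewrite -row_mul cover_ker row0.
have [||om omP] := IH chi (cone e g) n n0.
- move=> x t p ndt st pc; under eq_pairing => i do rewrite chiE //.
  by rewrite pairing_pull pc /pairing big1 // => j _; rewrite mxE mul0r.
- move=> x [|y t] p // ndt [st] pc.
  have -> : pairing p (mdelta d e (cone e g)) [:: x, y & t] = pairing p g [:: x, y & t].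
    apply: eq_pairing => i; apply: mdelta_cone => // xe.
    by apply: gZ; rewrite ?nd_cons2 1?eq_sym ?xe //= st.
  rewrite pairingZB pairing_pull pc [X in _ - X]/pairing big1 ?subr0 // => j _.
  by rewrite mxE mul0r.
(* Subtracting the coboundary of [om] makes [m * chi] vanish on the kernel without changing its own
   coboundary. *)
apply: (@descend K.+1 m f (fun i s => m%:Z * chi i s - mdelta d e om i s)).
  by move=> x t p ndt st pc; rewrite pairingZB omP // subrr.
by move=> i x t ndt st; rewrite mdeltaZB mdelta_mdelta // subr0 chiE.
Qed.

(** The shift now ends in degree 0, where a cocycle need not be a coboundary: at [x] it is a
    functional supported on the generators located at [x]. What remains is the torsion of
    functionals on the lattice of relations modulo these. *)
Lemma torsion_bound_base (m : nat) :
  (forall x (a : int) (y g : 'cV[int]_I), a != 0 ->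
    (forall i, e i != x -> g i 0 = 0) ->
    (forall p : 'rV_I, p *m cover x = 0 -> a *: (p *m y) = p *m g) ->
    exists2 h : 'cV[int]_I, (forall i, e i != x -> h i 0 = 0) &
      forall p : 'rV_I, p *m cover x = 0 -> m%:Z *: (p *m y) = p *m h) ->
  torsion_bound d c N 1 m.
Proof.
move=> latP f psi n n0 fZ fT; pose chi := cone e (pull f).
have fZ' i x t : nd (x :: t) -> size t = 2 -> mdelta d e (pull f) i (x :: t) = 0.
  by rewrite mdelta_pull; apply: pull_act.
have chiE i x t : nd (x :: t) -> size t = 1 ->
    mdelta d e chi i (x :: t) = pull f i (x :: t).
  case: t => [|y t] // ndt [st]; apply: mdelta_cone => // xe.
  by apply: fZ'; rewrite ?nd_cons2 1?eq_sym ?xe //= st.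
pose g i s := n * chi i s - pull psi i s.
have gZ i x t : nd (x :: t) -> size t = 1 -> mdelta d e g i (x :: t) = 0.
  move=> ndt st; rewrite mdeltaZB chiE // mdelta_pull /= -fT ?subrr //.
  by rewrite -row_mul cover_ker row0.
(* The cocycle condition on the tuple [[:: e i; x]] reads off the value of [g] at [x]. *)
have g0 i x : e i != x -> g i [:: x] = 0.
  move=> ex; have := gZ i (e i) [:: x]; rewrite nd_cons2 ex mdelta2 btwxxy //.
  by rewrite mul1r delta_short // subr0; apply.
have pairingE (p : 'rV_I) (h : 'I_I -> seq T -> int) s :
    pairing p h s = (p *m \col_i h i s) 0 0.
  by rewrite mxE; apply: eq_bigr => i _; rewrite mxE.
have /choice[h hP] x : exists h : 'cV[int]_I, (forall i, e i != x -> h i 0 = 0) /\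
      forall p : 'rV_I, p *m cover x = 0 -> m%:Z * pairing p chi [:: x] = (p *m h) 0 0.
  have [||h h0 hP] := latP x n (\col_i chi i [:: x]) (\col_i g i [:: x]) n0.
  - by move=> i ex; rewrite mxE g0.
  - move=> p pc; apply/matrixP => a b; rewrite !ord1 -pairingE mxE -pairingE pairingZB.
    rewrite pairing_pull pc [X in _ - X]/pairing big1 ?subr0 // => j _.
    by rewrite mxE mul0r.
  by exists h; split => // p pc; rewrite pairingE -hP // [RHS]mxE.
(* [k] is a cocycle: it can be non-zero at [[:: y]] only if [e i = y], and no other vertex lies
   between [y] and itself. *)
pose k (i : 'I_I) (s : seq T) : int := if s is x :: _ then h x i 0 else 0.
apply: (@descend 0 m f (fun i s => m%:Z * chi i s - k i s)).
  move=> x [|//] p _ _ pc; rewrite pairingZB (hP x).2 // pairingE.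
  by apply/eqP; rewrite subr_eq0; apply/eqP; congr (_ 0 0); congr (_ *m _);
    apply/colP => i; rewrite mxE.
move=> i x [|y [|//]] // ndt st; rewrite mdeltaZB chiE // mdelta2.
rewrite delta_short // subr0 /=; move: ndt; rewrite nd_cons2 => /andP[xy _].
case: (eqVneq (e i) y) => [ey|/(hP y).1 ->]; last by rewrite mulr0 subr0.
case: (boolP (btw d (e i) x y)) => [|_]; last by rewrite mul0r subr0.
by rewrite ey => /btw_ends/(_ _)/eqP; rewrite eq_sym => /(_ dM xy).
Qed.

End Shift.

(** * Leafless graphs *)

Definition nbr (T : finType) (d : T -> T -> nat) x : {set T} := [set y | d x y == 1%N].

(** [gm_genus] is twice the inequality [|E| - |V| + 1 <= g] for the simple graph of pairs at
    distance one, by the handshake lemma. Working with metrics turns the removal of a leaf into a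
    restriction to a subtype. *)
Record graph_metric (g : nat) (T : finType) (d : T -> T -> nat) : Prop := GraphMetric {
  gm_metric :> metric d;
  gm_geodesic : forall x c, x != c -> exists2 y, d x y = 1%N & d x c = (d y c).+1;
  gm_genus : (\sum_x #|nbr d x| + 2 <= 2 * #|T| + 2 * g)%N }.

Lemma card_sum (T : finType) (P : pred T) : #|[set y | P y]| = (\sum_y P y)%N.
Proof. by rewrite -sum1dep_card big_mkcond; apply: eq_bigr => y _; case: (P y). Qed.

Lemma sum2 (T : finType) : (\sum_(x : T) 2 = 2 * #|T|)%N.
Proof. by rewrite sum_nat_const mulnC. Qed.

(** * Counting irregular vertices *)

Section Irregular.
Variables (g : nat) (T : finType) (d : T -> T -> nat).
Hypothesis gd : graph_metric g d.
Hypothesis leafless : forall x, (2 <= #|nbr d x|)%N.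

Definition descents c x := #|[set y | (d x y == 1%N) && (d x c == (d y c).+1)]|.
Definition levels c x := #|[set y | (d x y == 1%N) && (d x c == d y c)]|.

Definition irregular c : {set T} :=
  [set x | [|| x == c, #|nbr d x| != 2, (1 < descents c x)%N | (0 < levels c x)%N]].

Lemma sum_excess : (\sum_x (#|nbr d x| - 2) <= 2 * g)%N.
Proof.
have := gm_genus gd; rewrite (eq_bigr (fun x => (#|nbr d x| - 2) + 2)%N); last first.
  by move=> x _; rewrite subnK.
by rewrite big_split /= sum2; move: (bigop _ _ _) #|T| => a b; lia.
Qed.

Lemma card_nbr_le x : (#|nbr d x| <= 2 + 2 * g)%N.
Proof. by have := sum_excess; rewrite (bigD1 x) //=; lia. Qed.

(** Ascents and descents are the same edges seen from opposite ends, so doubling the descents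
    recovers the sum of the degrees. *)
Lemma sum_descents c : (\sum_x (2 * descents c x + levels c x) + 2 <= 2 * #|T| + 2 * g)%N.
Proof.
have dS := dist_sym gd; have dT := dist_tri gd.
suff -> : (\sum_x (2 * descents c x + levels c x) = \sum_x #|nbr d x|)%N.
  exact: gm_genus gd.
pose up x := #|[set y | (d x y == 1%N) && (d y c == (d x c).+1)]|.
have up_down : (\sum_x up x = \sum_x descents c x)%N.
  rewrite /up /descents; under eq_bigr => x _ do rewrite card_sum.
  rewrite exchange_big; apply: eq_bigr => x _; rewrite card_sum.
  by apply: eq_bigr => y _; rewrite dS.
have -> : (\sum_x #|nbr d x| = \sum_x (up x + (descents c x + levels c x)))%N.
  apply: eq_bigr => x _; rewrite /up /descents /levels !card_sum -!big_split /=.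
  apply: eq_bigr => y _; case: eqP => //= dxy.
  have := dT x y c; have := dT y x c; rewrite (dS y x) dxy; lia.
rewrite [RHS]big_split /= up_down -big_split /=; apply: eq_bigr => x _; lia.
Qed.

Lemma descents_gt0 c x : x != c -> (0 < descents c x)%N.
Proof.
move=> xc; have [y dxy dyc] := gm_geodesic gd xc.
by apply/card_gt0P; exists y; rewrite inE dxy dyc !eqxx.
Qed.

(** One vertex is [c], at most [2 * g] have excess degree, and at most [2 * g] others are [bad]:
    every vertex except [c] contributes at least 2 to the sum in [sum_descents], and a bad one at
    least 3. *)
Lemma card_irregular c : (#|irregular c| <= 1 + 4 * g)%N.
Proof.
pose bad x := (x != c) && ((1 < descents c x) || (0 < levels c x))%N.
have bad_le : (\sum_x bad x <= 2 * g)%N.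
  have := sum_descents c.
  suff : (\sum_x (2 + bad x) <= \sum_x (2 * descents c x + levels c x + (x == c) * 2))%N.
    rewrite !big_split /= sum2 -[X in (_ <= _ + X)%N]big_distrl /=.
    have -> : (\sum_x (x == c) = 1)%N by rewrite (bigD1 c) //= eqxx big1 // => x /negPf->.
    by move: (bigop _ _ _) (bigop _ _ _) #|T| => a b n; lia.
  apply: leq_sum => x _; rewrite /bad; case: (eqVneq x c) => [|xc] /=; first lia.
  by have := descents_gt0 xc; lia.
have deg_le : (\sum_x (#|nbr d x| != 2) <= 2 * g)%N.
  apply: leq_trans sum_excess; apply: leq_sum => x _.
  by have := leafless x; case: eqP => //=; lia.
rewrite card_sum.
suff : (\sum_x (x \in irregular c) <= \sum_x ((x == c) + ((#|nbr d x| != 2) + bad x)))%N.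
  rewrite !big_split /=.
  have -> : (\sum_x (x == c) = 1)%N by rewrite (bigD1 c) //= eqxx big1 // => x /negPf->.
  under eq_bigr => x _ do rewrite inE.
  by lia.
by apply: leq_sum => x _; rewrite inE /bad; case: (x == c) => //=; case: (_ != _).
Qed.

(** Distances to [c] change by at most one along an edge; no neighbour is level with [x], and
    exactly one descends. *)
Lemma regularP c x y z : x \notin irregular c -> nbr d x = [set y; z] -> y != z ->
  (d x c = (d y c).+1 /\ d z c = (d x c).+1) \/ (d x c = (d z c).+1 /\ d y c = (d x c).+1).
Proof.
move=> xr nx yz.
have nbrE w : (d x w == 1%N) = (w == y) || (w == z).
  by have := congr1 (fun A : {set T} => w \in A) nx; rewrite /= !inE.
have xy : d x y = 1%N by apply/eqP; rewrite nbrE eqxx.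
have xz : d x z = 1%N by apply/eqP; rewrite nbrE eqxx orbT.
have dS := dist_sym gd; have dT := dist_tri gd.
move: xr; rewrite inE !negb_or -!leqNgt leqn0 => /and4P[xc _ desc1 /eqP/cards0_eq lev0].
have lev w : d x w = 1%N -> d x c <> d w c.
  move=> xw xwc; have : w \in set0 by rewrite -lev0 inE xw xwc !eqxx.
  by rewrite inE.
have [w xw wc] := gm_geodesic gd xc.
have two : ~ (d x c = (d y c).+1 /\ d x c = (d z c).+1).
  case=> yc zc; suff : (#|[set y; z]| <= descents c x)%N.
    by rewrite cards2 yz => /leq_trans/(_ desc1).
  by apply/subset_leq_card/subsetP => v /set2P[] ->; rewrite inE ?xy ?xz -?yc -?zc !eqxx.
have := lev y xy; have := lev z xz; have := dT x y c; have := dT y x c.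
have := dT x z c; have := dT z x c; rewrite (dS y x) (dS z x) xy xz.
have /orP[/eqP wE|/eqP wE] : (w == y) || (w == z) by rewrite -nbrE xw.
all: move: wc two; rewrite wE; lia.
Qed.

Lemma irregular_deg c x : x \notin irregular c ->
  x != c /\ exists y z, y != z /\ nbr d x = [set y; z].
Proof.
rewrite inE !negb_or negbK => /and4P[xc /cards2P[y [z [yz nx]]] _ _].
by split=> //; exists y, z.
Qed.

End Irregular.

(** * Generators of kernels *)

Section Generation.
Variables (g : nat) (T : finType) (d : T -> T -> nat).
Hypothesis gd : graph_metric g d.

(** Transport from [y] to [x] kills no coordinate of [v]. Moreover [y] is closer than [x] to each
    generator in the support of [v], which lets an induction terminate. *)
Definition carried J (c : 'I_J -> T) x (u : 'rV[int]_J) y (v : 'rV[int]_J) :=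
  forall j, v 0 j != 0 -> [/\ u 0 j != 0, y != x & btw d (c j) y x].

(* Outside [X] the module [ker N] has no new generators: each element at [x] is
   transported to [x] from other points. *)
Definition generated J J' (c : 'I_J -> T) (N : T -> 'M[int]_(J, J')) (X : {set T}) :=
  forall x (u : 'rV_J), x \notin X -> u *m N x = 0 ->
  exists y1 u1 y2 u2, [/\ u = u1 + u2, u1 *m N y1 = 0, u2 *m N y2 = 0,
    carried c x u y1 u1 & carried c x u y2 u2].

Definition transportable J J' (c : 'I_J -> T) (N : T -> 'M[int]_(J, J')) :=
  forall x y (u : 'rV_J), u *m N x = 0 -> (\row_j (u 0 j *+ btw d (c j) x y)) *m N y = 0.

Lemma cover_act J I (c : 'I_J -> T) (e : 'I_I -> T) (F : 'M[int]_(I, J)) x y (u : 'rV_I) j :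
  ((\row_i (u 0 i *+ btw d (e i) x y)) *m cover d c e F y) 0 j =
  (u *m cover d c e F x) 0 j *+ btw d (c j) x y.
Proof.
rewrite !mxE -sumrMnl; apply: eq_bigr => i _; rewrite !mxE.
have := btw4 (dist_tri gd) (c j) (e i) x y.
by do 4![case: (btw d _ _ _)] => //= _; ring.
Qed.

Lemma cover_transport J I (c : 'I_J -> T) (e : 'I_I -> T) (F : 'M[int]_(I, J)) :
  transportable e (cover d c e F).
Proof. by move=> x y u ux; apply/rowP => j; rewrite cover_act ux !mxE mul0rn. Qed.

Section Cover.
Variables (J J' : nat) (c : 'I_J -> T) (N : T -> 'M[int]_(J, J')).
Variables (E : T -> 'M[int]_J) (s : nat) (pts : 'I_s -> T) (X : {set T}).
Hypothesis EN : forall x, E x *m N x = 0.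
Hypothesis EK : forall x (u : 'rV_J), u *m N x = 0 -> u *m E x = u.
Hypothesis genX : generated c N X.
Hypothesis ptsX : forall x, x \in X -> exists a, pts a = x.

(** A generator is a listed point together with a row of the kernel projection there; [enum_val]
    flattens such pairs into matrix indices. *)
Definition gen_pt (i : 'I_#|{: 'I_s * 'I_J}|) : T := pts (enum_val i).1.
Definition gen_mx : 'M[int]_(_, J) := \matrix_i row (enum_val i).2 (E (gen_pt i)).

Lemma gen_mx_ker i : row i gen_mx *m N (gen_pt i) = 0.
Proof. by rewrite rowK -row_mul EN row0. Qed.

(** Induction on a bound for the distances from [x] to the generators in the support of [u]. On [X]
    the rows of [E x] span the kernel; elsewhere [u] splits into two parts transported from points
    closer to those generators. *)
Lemma cover_onto x (u : 'rV_J) : u *m N x = 0 ->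
  exists p : 'rV_ _, p *m cover d c gen_pt gen_mx x = u.
Proof.
have [n] : exists n, forall j, u 0 j != 0 -> (d x (c j) < n)%N.
  by exists (\max_j d x (c j)).+1 => j _; rewrite ltnS leq_bigmax.
elim: n x u => [|n IH] x u un ux.
  exists 0; rewrite mul0mx; apply/rowP => j; rewrite mxE.
  by case: (eqVneq (u 0 j) 0) => // /un.
case: (boolP (x \in X)) => [/ptsX[a ax]|xX].
  exists (\sum_r u 0 r *: delta_mx 0 (enum_rank (a, r))).
  rewrite -[RHS](EK ux) mulmx_suml mulmx_sum_row; apply: eq_bigr => r _.
  rewrite -scalemxAl -rowE; congr (_ *: _); apply/rowP => j.
  rewrite !mxE /gen_pt !enum_rankK /= ax /btw (dist_xx gd) addn0 eqxx.
  by rewrite mulr1n.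
have [y1 [u1 [y2 [u2 [uE u1y u2y c1 c2]]]]] := genX xX ux.
have lift_carried y v : v *m N y = 0 -> carried c x u y v ->
    exists p : 'rV_ _, p *m cover d c gen_pt gen_mx x = v.
  move=> vy cv; have [j vj|p pv] := IH y v _ vy.
    have [/un xn yx] := cv _ vj; rewrite -(dist_eq0 gd) in yx; rewrite /btw => /eqP.
    by rewrite (dist_sym gd (c j) y) (dist_sym gd (c j) x); lia.
  exists (\row_i (p 0 i *+ btw d (gen_pt i) y x)); apply/rowP => j.
  rewrite cover_act pv; case: (eqVneq (v 0 j) 0) => [->|/cv[_ _ ->]]; last by [].
  by rewrite mul0rn.
have [p1 p1E] := lift_carried y1 u1 u1y c1; have [p2 p2E] := lift_carried y2 u2 u2y c2.
by exists (p1 + p2); rewrite mulmxDl p1E p2E uE.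
Qed.

Lemma cover_section : exists S : T -> 'M[int]_(J, _), forall x (u : 'rV_J),
  u *m N x = 0 -> u *m S x *m cover d c gen_pt gen_mx x = u.
Proof.
suff /choice[S SP] x : exists S : 'M[int]_(J, _), S *m cover d c gen_pt gen_mx x = E x.
  by exists S => x u ux; rewrite -mulmxA SP EK.
have /choice[p pP] r : exists p : 'rV_ _, p *m cover d c gen_pt gen_mx x = row r (E x).
  by apply: cover_onto; rewrite -row_mul EN row0.
by exists (\matrix_r p r); apply/row_matrixP => r; rewrite row_mul rowK pP.
Qed.

End Cover.
Hypothesis leafless : forall x, (2 <= #|nbr d x|)%N.

Section Special.
Variables (J I : nat) (c : 'I_J -> T) (e : 'I_I -> T) (F : 'M[int]_(I, J)).

Definition singular : {set T} :=
  (\bigcup_i irregular d (e i)) :|: (\bigcup_j irregular d (c j)).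

(** Splitting a relation at [x] between its two neighbours requires these to be regular as well. *)
Definition special : {set T} := singular :|: \bigcup_(x in singular) nbr d x.

Lemma card_special : (#|special| <= (I + J) * (1 + 4 * g) * (3 + 2 * g))%N.
Proof.
have bigcup_le (K : finType) (P : pred K) (A : K -> {set T}) b :
    (forall i, #|A i| <= b)%N -> (#|\bigcup_(i | P i) A i| <= #|P| * b)%N.
  move=> Ab; rewrite -sum_nat_const; elim/big_rec2: _ => [|i n B _ le_Bn].
    by rewrite cards0.
  by apply: leq_trans (leq_card_setU _ _) _; rewrite leq_add.
have leU (A B : {set T}) : (#|A :|: B| <= #|A| + #|B|)%N by rewrite leq_card_setU.
have sing : (#|singular| <= (I + J) * (1 + 4 * g))%N.
  apply: leq_trans (leU _ _) _; rewrite mulnDl leq_add //.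
    by rewrite -[X in (X * _)%N]card_ord; apply: bigcup_le => i; apply: card_irregular.
  by rewrite -[X in (X * _)%N]card_ord; apply: bigcup_le => i; apply: card_irregular.
apply: leq_trans (leU _ _) _.
apply: leq_trans (leq_add (leqnn _) (bigcup_le _ (mem singular) _ _ (card_nbr_le gd leafless))) _.
by rewrite -[X in (X + _)%N]muln1 -mulnDr addnA leq_mul2r sing orbT.
Qed.

Lemma notin_singular x : x \notin singular ->
  (forall i, x \notin irregular d (e i)) /\ (forall j, x \notin irregular d (c j)).
Proof.
rewrite inE negb_or => /andP[/bigcupP xe /bigcupP xc].
by split=> i; apply/negP => xi; [apply: xe | apply: xc]; exists i.
Qed.

(** If [y] is on the side of [c j], the generators on the side of [z] contribute nothing to column
    [j] at [x], and those on the side of [y] have equal coefficients at [x] and [y]; so the equation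
    at [x] gives the one at [y]. *)
Lemma transport_side x y z (p : 'rV_I) : x \notin singular -> y \notin singular ->
  nbr d x = [set y; z] -> y != z -> p *m cover d c e F x = 0 ->
  (\row_i (p 0 i *+ (d x (e i) == (d y (e i)).+1))) *m cover d c e F y = 0.
Proof.
move=> /notin_singular[xe xc] /notin_singular[yeN ycN].
move=> nx yz px; have dS := dist_sym gd; have dT := dist_tri gd.
have xeP i := regularP gd (xe i) nx yz.
have xcP j := regularP gd (xc j) nx yz.
apply/rowP => j; rewrite !mxE; have /rowP/(_ j) := px; rewrite !mxE => px0.
have [[xcj zcj]|[xcj ycj]] := xcP j.
  rewrite -[RHS]px0; apply: eq_bigr => i _; rewrite !mxE /btw.
  have := dT (c j) (e i) z; rewrite !(dS _ x) !(dS _ y) !(dS _ z).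
  have [[xei zei]|[xei yei]] := xeP i => tri.
    rewrite xei eqxx mulr1n; congr (_ * (_ *+ _)); congr (nat_of_bool _); lia.
  rewrite (_ : (_ == (d y (e i)).+1) = false); last lia.
  rewrite mulr0n mul0r (_ : (_ == d x (c j)) = false) ?mulr0n ?mulr0 //; lia.
(* Here [y] points away from [c j] but towards [e i]. The neighbour of [y] other than [x] is then
   closer to [e i] and farther from [c j], so [e i] cannot lie on a geodesic from [c j] to [y]. *)
rewrite big1 // => i _; rewrite !mxE; case: eqP => [xei|_]; last by rewrite mulr0n mul0r.
suff /negPf-> : ~~ btw d (c j) (e i) y by rewrite mulr0n mulr0.
have [_ [y1 [y2 [y12 ny]]]] := irregular_deg (ycN j).
have xny : x \in [set y1; y2].
  have : y \in nbr d x by rewrite nx !inE eqxx.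
  by rewrite -ny !inE dS.
have yeP := regularP gd (yeN i) ny y12; have ycP := regularP gd (ycN j) ny y12.
have := dT (c j) (e i) y1; have := dT (c j) (e i) y2.
rewrite /btw !(dS _ y1) !(dS _ y2) !(dS _ y).
by case/set2P: xny => xE; move: xei xcj ycj yeP ycP; rewrite xE; lia.
Qed.

(** Each coordinate of a relation at [x] is assigned to the neighbour closer to its generator; by
    [transport_side] both parts are again relations. *)
Lemma generated_cover : generated e (cover d c e F) special.
Proof.
move=> x p; rewrite inE negb_or => /andP[xs /bigcupP xn] px.
have [xe _] := notin_singular xs.
(* With no generator there are no coordinates, and the conditions on the parts are vacuous. *)
case: (pickP 'I_I) => [i0 _|I0]; last first.
  have J0 (Q : Prop) : 'I_I -> Q by move=> i; have := I0 i.
  exists x, p, x, 0; rewrite addr0 mul0mx.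
  by split=> // j; apply: J0 j.
have [_ [y [z [yz nx]]]] := irregular_deg (xe i0).
have dS := dist_sym gd.
have nbr_ns w : w \in nbr d x -> w \notin singular.
  by move=> wx; apply/negP => ws; apply: xn; exists w => //; move: wx; rewrite !inE dS.
have yx : y \in nbr d x by rewrite nx !inE eqxx.
have zx : z \in nbr d x by rewrite nx !inE eqxx orbT.
have [ys zs] := (nbr_ns y yx, nbr_ns z zx).
move: yx zx; rewrite !inE => /eqP dxy /eqP dxz.
exists y, (\row_i (p 0 i *+ (d x (e i) == (d y (e i)).+1))), z,
  (\row_i (p 0 i *+ (d x (e i) == (d z (e i)).+1))).
split.
- apply/rowP => i; rewrite !mxE.
  have [[xei zei]|[xei yei]] := regularP gd (xe i) nx yz.
    by rewrite xei eqxx (_ : (_ == (d z _).+1) = false) ?addr0 // zei; lia.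
  by rewrite xei eqxx (_ : (_ == (d y _).+1) = false) ?add0r // yei; lia.
- exact: transport_side nx yz px.
- by apply: (transport_side (z := y)) px; rewrite // 1?eq_sym // nx setUC.
- move=> i; rewrite mxE; case: (d x (e i) =P (d y (e i)).+1) => [xei|]; last by rewrite eqxx.
  rewrite mulr1n => ->; split=> //; first by rewrite -(dist_eq0 gd) dS dxy.
  by rewrite /btw (dS (e i) y) (dS (e i) x) (dS y x) dxy xei addn1.
- move=> i; rewrite mxE; case: (d x (e i) =P (d z (e i)).+1) => [xei|]; last by rewrite eqxx.
  rewrite mulr1n => ->; split=> //; first by rewrite -(dist_eq0 gd) dS dxz.
  by rewrite /btw (dS (e i) z) (dS (e i) x) (dS z x) dxz xei addn1.
Qed.

End Special.
End Generation.

(** Padding with [x0] gives exactly [s] points, so that matrix sizes depend on the bound alone. *)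
Lemma small_set_points (T : finType) (x0 : T) (X : {set T}) s : (#|X| <= s)%N ->
  exists pts : 'I_s -> T, forall x, x \in X -> exists a, pts a = x.
Proof.
move=> Xs; exists (fun a => nth x0 (enum X) a) => x xX.
have ix : (index x (enum X) < s)%N.
  by apply: leq_trans Xs; rewrite cardE index_mem mem_enum.
by exists (Ordinal ix); rewrite /= nth_index ?mem_enum.
Qed.

(** The induction leaves the sizes and bounds free: a cover step replaces [J], [J'], [B], [s] by
    [s * J], [J], [B'] and the bound of [card_special], none of which depends on the graph. *)
Lemma core_torsion_bound g K J J' B s : exists2 m, (0 < m)%N &
  forall (T : finType) (d : T -> T -> nat), graph_metric g d ->
  (forall x, (2 <= #|nbr d x|)%N) ->
  forall (c : 'I_J -> T) (N : T -> 'M[int]_(J, J')) (X : {set T}),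
  (forall x i j, (`|N x i j| <= B)%N) -> transportable d c N ->
  (#|X| <= s)%N -> generated d c N X -> torsion_bound d c N K.+1 m.
Proof.
elim: K J J' B s => [|K IH] J J' B s; have [B' B'P] := kermx_proj_bounded J J' B.
  pose I := #|{: 'I_s * 'I_J}|.
  have [m m0 mP] := restricted_functionals_torsion I J B'.
  exists m => // T d gd leafless c N X NB Nact Xs genX.
  case: (pickP T) => [x0 _|T0]; last by move=> f psi n _ _ _; exists psi => x; have := T0 x.
  have /choice[E EP] x := B'P _ (NB x).
  have [pts ptsX] := small_set_points x0 Xs.
  have [S SP] := cover_section gd (fun x => let: And3 h _ _ := EP x in h)
    (fun x => let: And3 _ h _ := EP x in h) genX ptsX.
  have FN := gen_mx_ker pts (fun x => let: And3 h _ _ := EP x in h).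
  apply: (torsion_bound_base gd Nact FN SP) => x a y h a0 hx hP.
  have [||w w0 wP] := mP (cover d c (gen_pt pts) (gen_mx E pts) x)
    [set i | gen_pt pts i == x] _ a y h a0 _ hP.
  - move=> i j; rewrite !mxE; have [_ _ EB] := EP (gen_pt pts i).
    by case: btw; [apply: EB | rewrite mulr0n].
  - by move=> i; rewrite inE => /hx.
  by exists w => // i ix; apply: w0; rewrite inE.
pose I := #|{: 'I_s * 'I_J}|.
have [m m0 mP] := IH I J B' ((I + J) * (1 + 4 * g) * (3 + 2 * g))%N.
exists m => // T d gd leafless c N X NB Nact Xs genX.
case: (pickP T) => [x0 _|T0]; last by move=> f psi n _ _ _; exists psi => x; have := T0 x.
have /choice[E EP] x := B'P _ (NB x).
have [pts ptsX] := small_set_points x0 Xs.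
have [S SP] := cover_section gd (fun x => let: And3 h _ _ := EP x in h)
  (fun x => let: And3 _ h _ := EP x in h) genX ptsX.
have FN := gen_mx_ker pts (fun x => let: And3 h _ _ := EP x in h).
apply: (torsion_bound_shift gd Nact FN SP).
apply: (mP _ _ gd leafless _ _ (special d c (gen_pt pts))).
- move=> x i j; rewrite !mxE; have [_ _ EB] := EP (gen_pt pts i).
  by case: btw; [apply: EB | rewrite mulr0n].
- by apply: (cover_transport gd).
- by apply: (card_special gd leafless).
by apply: (generated_cover gd).
Qed.

(** * Pruning leaves *)

(** All lengths are treated at once: [delta] relates only tuples of equal length, so the grading can
    be restored at the end. *)
Definition magnitude_torsion (T : eqType) (d : T -> T -> nat) k (m : nat) :=
  forall f psi (n : int), n != 0 ->
  (forall s, nd s -> size s = k.+2 -> delta d f s = 0) ->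
  (forall s, nd s -> size s = k.+1 -> n * f s = delta d psi s) ->
  exists psi', forall s, nd s -> size s = k.+1 -> m%:Z * f s = delta d psi' s.

(** With the first vertex [b] fixed, the rest of a tuple is a cochain on a module of rank one, which
    is zero at [b] because the second vertex differs from [b]. It is generated by the neighbours of
    [b], whence [2 + 2 * g]. *)
Lemma magnitude_torsion_core g k : exists2 m, (0 < m)%N &
  forall (T : finType) (d : T -> T -> nat), graph_metric g d ->
  (forall x, (2 <= #|nbr d x|)%N) -> magnitude_torsion d k.+2 m.
Proof.
have [m m0 mP] := core_torsion_bound g k 1 1 1 (2 + 2 * g).
exists m => // T d gd leafless f psi n n0 fZ fT.
pose c b (_ : 'I_1) : T := b.
pose N (b x : T) : 'M[int]_1 := (x == b)%:R%:M.
pose at_ (f : seq T -> int) b (_ : 'I_1) s := f (b :: s).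
have N0 b x (u : 'rV[int]_1) : (u *m N b x == 0) = (x != b) || (u == 0).
  rewrite /N mul_mx_scalar; case: (x == b); rewrite ?scale1r ?scale0r ?eqxx //.
have pairingE (u : 'rV[int]_1) (h : 'I_1 -> seq T -> int) s : pairing u h s = u 0 0 * h 0 s.
  by rewrite /pairing big_ord1.
have mdeltaE (h : seq T -> int) b x t : mdelta d (c b) (at_ h b) 0 (x :: t) = delta d h [:: b, x & t].
  by rewrite /mdelta; apply: delta_cons.
have bP b : torsion_bound d (c b) (N b) k.+1 m.
  apply: (mP _ _ gd leafless _ _ (nbr d b)).
  - by move=> x i j; rewrite !ord1 mxE mulr1n; case: (x == b).
  - move=> x y u /eqP; rewrite N0 => ux; apply/eqP; rewrite N0.
    case: (eqVneq y b) => //= yb; apply/eqP/rowP => j; rewrite !mxE.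
    case/orP: ux => [xb|/eqP->]; last by rewrite mxE mul0rn.
    case: (boolP (btw d _ _ _)) => // /(btw_ends gd).
    by rewrite /c yb eqxx eq_sym => /(_ xb).
  - exact: card_nbr_le gd leafless b.
  move=> x u; rewrite inE => xb /eqP; rewrite N0.
  case: (eqVneq x b) => [_ /= /eqP-> | xNb _].
    exists x, 0, x, 0; rewrite addr0 mul0mx.
    by split=> // j; rewrite mxE eqxx.
  have [y dxy dxb] := gm_geodesic gd xNb.
  have yb : y != b.
    by apply: contra xb => /eqP <-; rewrite (dist_sym gd) dxy.
  exists y, u, y, 0; rewrite addr0 mul0mx; split=> // [|j uj|j].
  - by apply/eqP; rewrite N0 yb.
  - split=> //; first by rewrite -(dist_eq0 gd) (dist_sym gd) dxy.
    by rewrite /btw /c (dist_sym gd b y) (dist_sym gd b x) (dist_sym gd y x) dxy dxb addn1.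
  by rewrite mxE eqxx.
have /choice[psi' psi'P] b : exists psi', forall x t u, nd (x :: t) -> size t = k.+1 ->
    u *m N b x = 0 -> m%:Z * pairing u (at_ f b) (x :: t) = pairing u (mdelta d (c b) psi') (x :: t).
  apply: (bP b (at_ f b) (at_ psi b) n n0) => [|x t u ndt st /eqP].
    move=> x t u ndt st /eqP; rewrite N0 pairingE mdeltaE => /orP[xb|/eqP->].
      by rewrite fZ ?mulr0 //= ?st // nd_cons2 eq_sym xb.
    by rewrite mxE mul0r.
  rewrite N0 !pairingE mdeltaE => /orP[xb|/eqP->]; last by rewrite mxE !mul0r mulr0.
  by rewrite -fT ?nd_cons2 1?eq_sym ?xb //= ?st //; ring.
exists (fun s => if s is b :: t then psi' b 0 t else 0) => -[|b [|x t]] // + [st].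
rewrite nd_cons2 eq_sym => /andP[xb ndt].
have := psi'P b x t 1%:M ndt st; rewrite !pairingE mxE !mul1r => -> //.
by apply/eqP; rewrite N0 xb.
Qed.

(** * The homotopy at a leaf *)

Section Leaf.
Variables (T : eqType) (d : T -> T -> nat) (v u : T).
Hypothesis dM : metric d.
Hypothesis vu : v != u.
Hypothesis leaf : forall x, x != v -> d v x = (d u x).+1.

Let leaf' x : x != v -> d x v = (d x u).+1.
Proof. by move=> xv; rewrite (dist_sym dM) leaf // (dist_sym dM). Qed.

(* The homotopy [ins] inserts [u] between consecutive vertices exactly one of which is [v]. *)
Definition gap x y := [&& x == v, y != u & y != v] || [&& y == v, x != u & x != v].

Lemma leaf_not_between x z : x != v -> z != v -> ~~ btw d x v z.
Proof.
move=> xv zv; rewrite /btw leaf' // leaf //; have := dist_tri dM x u z; lia.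
Qed.

Lemma btw_gap x y : gap x y -> btw d x u y.
Proof.
have dvu : d v u = 1%N by rewrite leaf 1?eq_sym // (dist_xx dM).
case/orP => /and3P[/eqP-> yu yv]; rewrite /btw.
  by rewrite dvu leaf // add1n.
by rewrite (dist_sym dM u v) dvu leaf' // addn1.
Qed.

(** Deleting [y] and then inserting [u] is balanced by inserting [u] on either side of [y] and then
    deleting [y]. The excluded case [y = u] feeds [cnt] instead. *)
Lemma gap_exchange x y z : x != y -> y != z -> y != u ->
  ((btw d x y z && gap x z) = (gap x y && btw d u y z) + (gap y z && btw d x y u) :> nat)%N.
Proof.
move=> xy yz yu; have dyu : (0 < d y u)%N by rewrite lt0n (dist_eq0 dM).
have duy : (0 < d u y)%N by rewrite (dist_sym dM).
rewrite /gap; case: (eqVneq y v) => [yv|yv].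
  rewrite yv in xy yz *.
  have zv : z != v by rewrite eq_sym.
  rewrite (negPf xy) (negPf zv) /= !andbT.
  have uv : u != v by rewrite eq_sym.
  by rewrite !(negPf (leaf_not_between _ _)) ?andbF.
rewrite yu /=; case: (eqVneq x v) => [xv|xv] /=; case: (eqVneq z v) => [zv|zv] /=; rewrite ?andbF ?andbT ?orbF //=.
- rewrite xv zv /btw (leaf' yv) (leaf yv) (dist_sym dM u v) leaf 1?eq_sym //.
  by rewrite (dist_xx dM); lia.
- have := leaf yv; rewrite xv /btw (leaf zv) => ->.
  case: (eqVneq z u) => [->|zu] /=; first by rewrite (dist_xx dM); lia.
  by rewrite andbT addn0 addSn eqSS.
- have := leaf' yv; rewrite zv /btw (leaf' xv) => ->.
  case: (eqVneq x u) => [->|xu] /=; first by rewrite (dist_xx dM); lia.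
  by rewrite andbT addnS eqSS.
Qed.

Fixpoint ins (f : seq T -> int) (s : seq T) : int :=
  if s is x :: s1 then
    if s1 is y :: _ then (gap x y)%:R * f [:: x, u & s1] - ins (fun t => f (x :: t)) s1
    else 0
  else 0.

(** The eigenvalue of the homotopy: places where [u] can be inserted, plus inner occurrences of [u]
    that [ins] would restore after their deletion. *)
Fixpoint cnt (s : seq T) : nat :=
  if s is x :: s1 then
    if s1 is y :: s2 then
      (gap x y + (if s2 is z :: _ then (y == u) && (btw d x u z && gap x z) else false)
       + cnt s1)%N
    else 0%N
  else 0%N.

Lemma insE f x y s : ins f [:: x, y & s] =
  (gap x y)%:R * f [:: x, u, y & s] - ins (fun t => f (x :: t)) (y :: s).
Proof. by []. Qed.

Lemma cntE x y s : cnt [:: x, y & s] =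
  (gap x y + (if s is z :: _ then (y == u) && (btw d x u z && gap x z) else false)
   + cnt (y :: s))%N.
Proof. by []. Qed.

Lemma ins_short f s : (size s <= 1)%N -> ins f s = 0.
Proof. by case: s => [|x [|y s]]. Qed.

Arguments ins : simpl never.
Arguments cnt : simpl never.

Lemma ins_ext f f' s :
  (forall p x y q, s = p ++ [:: x, y & q] -> gap x y ->
     f (p ++ [:: x, u, y & q]) = f' (p ++ [:: x, u, y & q])) ->
  ins f s = ins f' s.
Proof.
elim: s f f' => [|x [|y s] IH] f f' ff'; try by rewrite !ins_short.
rewrite !insE; congr (_ - _).
  case: (boolP (gap x y)) => [b|_]; last by rewrite !mul0r.
  by rewrite (ff' [::] x y s).
apply: IH => p x' y' q E b; exact: (ff' (x :: p) x' y' q (congr1 (cons x) E) b).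
Qed.

Lemma ins_cons f f' x s :
  (forall t, f (x :: t) = f' (x :: t)) -> ins f (x :: s) = ins f' (x :: s).
Proof. by move=> ff'; apply: ins_ext => -[|y p] x' y' q [<- _] _; apply: ff'. Qed.

Lemma ins_lin a f f' s : ins (fun t => a * f t - f' t) s = a * ins f s - ins f' s.
Proof.
elim: s f f' => [|x [|y s] IH] f f'; try by rewrite !ins_short // mulr0 subrr.
by rewrite !insE (IH (fun t => f (x :: t)) (fun t => f' (x :: t))); ring.
Qed.

Lemma ins_scale a f s : ins (fun t => a * f t) s = a * ins f s.
Proof.
elim: s f => [|x [|y s] IH] f; try by rewrite !ins_short // mulr0.
by rewrite !insE (IH (fun t => f (x :: t))); ring.
Qed.

(** Insertions and deletions at distant places cancel by sign, adjacent ones by [gap_exchange];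
    inserting and deleting the same [u] leaves the diagonal term. *)
Lemma ins_homotopy f s : nd s ->
  delta d (ins f) s + ins (delta d f) s = (cnt s)%:Z * f s.
Proof.
elim: s f => [|x s IH] f; first by rewrite delta_short // ins_short // mul0r.
case: s IH => [|y s] IH; first by rewrite delta_short // ins_short // mul0r.
rewrite nd_cons2 => /andP[xy nds]; have {IH}IH := IH (fun t => f (x :: t)) nds.
have gxy : (gap x y)%:Z = (gap x y)%:Z * (btw d x u y)%:Z.
  by case: (boolP (gap x y)) => // /btw_gap->.
case: s nds IH => [|z s] nds IH.
  rewrite delta_short // insE ins_short // cntE !addn0 deltaE delta_short //.
  by rewrite [in RHS]gxy !natz; ring.
move: nds; rewrite nd_cons2 => /andP[yz nds].
pose B t := if t is [:: y', z' & r] then (btw d x y' z')%:R * f [:: x, z' & r] else 0.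
have BE t : delta d f (x :: t) = 1 * B t - delta d (fun t => f (x :: t)) t.
  by case: t => [|y' [|z' r]]; rewrite ?deltaE // mul1r // !delta_short // subrr.
have E1 : delta d (ins f) [:: x, y, z & s] = (btw d x y z)%:R *
   ((gap x z)%:R * f [:: x, u, z & s] - ins (fun t => f (x :: t)) (z :: s)) -
   ((gap x y)%:R * delta d (fun t => f [:: x, u & t]) [:: y, z & s]
    - delta d (ins (fun t => f (x :: t))) [:: y, z & s]).
  rewrite deltaE insE -deltaZ -deltaB; congr (_ - _).
have E2 : ins (delta d f) [:: x, y, z & s] =
   (gap x y)%:R * ((btw d x u y)%:R * f [:: x, y, z & s] -
    ((btw d u y z)%:R * f [:: x, u, z & s] - delta d (fun t => f [:: x, u & t]) [:: y, z & s]))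
   - ((gap y z)%:R * ((btw d x y u)%:R * f [:: x, u, z & s])
      - (btw d x y z)%:R * ins (fun t => f (x :: t)) (z :: s)
      - ins (delta d (fun t => f (x :: t))) [:: y, z & s]).
  rewrite insE 2!deltaE; congr (_ - _).
  rewrite (ins_cons (f' := fun t => 1 * B t - delta d (fun t => f (x :: t)) t)) => [|t]; last exact: BE.
  rewrite ins_lin mul1r; congr (_ - _).
  rewrite insE; congr (_ - _).
  by rewrite -ins_scale; apply: ins_cons => t.
rewrite E1 E2 cntE !PoszD mulrDl -IH gxy.
have := gap_exchange xy yz; case: (eqVneq y u) => [yu _ | yu /(_ isT)] /=.
  have gxu : gap x u = false by rewrite /gap eqxx (eq_sym u) (negPf vu) andbF.
  have guz : gap u z = false by rewrite /gap eqxx (eq_sym u) (negPf vu) andbF.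
  rewrite yu gxu guz; case: (btw d x u z) => //=; case: (gap x z) => /=; rewrite ?natz; ring.
move=> ex; have {}ex : (btw d x y z)%:Z * (gap x z)%:Z
   = (gap x y)%:Z * (btw d u y z)%:Z + (gap y z)%:Z * (btw d x y u)%:Z.
  by rewrite -!PoszM !mulnb ex PoszD.
rewrite addr0 !natz; apply/eqP; rewrite -subr_eq0; apply/eqP.
transitivity (((btw d x y z)%:Z * (gap x z)%:Z - ((gap x y)%:Z * (btw d u y z)%:Z
   + (gap y z)%:Z * (btw d x y u)%:Z)) * f [:: x, u, z & s]); first by ring.
by rewrite ex subrr mul0r.
Qed.

Lemma cnt_le s : (cnt s <= 2 * size s)%N.
Proof.
elim: s => [|x [|y s] IH] //; rewrite cntE [size _]/= mulnS leq_add //.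
by case: (gap x y); case: s {IH} => // z s; case: (_ && _).
Qed.

Lemma nd_cat (p q : seq T) : nd (p ++ q) -> nd q.
Proof. by rewrite /nd; elim: p => //= x p IH /path_sorted/IH. Qed.

(** Only [u] can stand next to [v] without a gap, and only [v] can stand on the other side of that
    [u], since otherwise deleting [u] would leave a gap. *)
Lemma cnt0_alternating s : nd s -> v \in s -> cnt s = 0%N ->
  all (fun x => (x == u) || (x == v)) s.
Proof.
elim: s => [|x [|y s] IH] // nds.
  by rewrite inE eq_sym /= andbT => ->; rewrite orbT.
move: (nds); rewrite nd_cons2 => /andP[xy ndy] vs /eqP.
rewrite cntE !addn_eq0 -andbA => /and3P[].
case: (boolP (v \in y :: s)) => [vys|vys] g0 h0 /eqP c0.
  have ally := IH ndy vys c0; rewrite /= in ally *; rewrite ally andbT.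
  have /andP[/orP[/eqP yu|/eqP yv] alls] := ally; last first.
    by move: g0 xy; rewrite yv /gap eqxx => + xv; rewrite (negPf xv) /=; case: (x == u).
  case: s vys nds h0 alls ndy {ally c0 IH vs} => [|z s].
    by rewrite yu inE (negPf vu).
  move=> _ _ h0 /= /andP[zuv _]; rewrite nd_cons2 yu => /andP[uz _].
  have zv : z = v by apply/eqP; move: zuv; rewrite eq_sym (negPf uz).
  case: (eqVneq x v) => [|xv]; first by rewrite orbT.
  have gxz : gap x z by rewrite /gap zv eqxx xv -yu xy /= orbT.
  by move: h0; rewrite yu eqxx btw_gap ?gxz.
have xv : x = v by move: vs; rewrite inE (negPf vys) orbF => /eqP.
have yv : y != v by rewrite eq_sym -xv.
have yu : y = u.
  by apply/eqP; move: g0; rewrite /gap xv eqxx yv (negPf yv) /= orbF andbT eqb0 negbK.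
case: s nds h0 ndy vys {c0 IH vs} => [|z s] nds h0.
  by rewrite /= xv yu !eqxx orbT.
rewrite nd_cons2 !inE !negb_or => /andP[yz _] /and3P[_ vz _].
have gxz : gap x z by rewrite /gap xv eqxx (eq_sym z v) vz (eq_sym z) -yu yz.
by move: h0; rewrite yu eqxx btw_gap ?gxz.
Qed.

(** The two neighbours of an inner vertex coincide, so no inner vertex lies on a geodesic between
    them. *)
Lemma delta_alternating psi s : nd s -> all (fun x => (x == u) || (x == v)) s ->
  delta d psi s = 0.
Proof.
move=> nds alls; apply: delta_supp => p x y z q sE.
move: nds alls; rewrite sE all_cat => /nd_cat; rewrite !nd_cons2 => /and3P[xy yz _].
move=> /andP[_] /= /and4P[xuv yuv zuv _]; apply/negP => /(btw_ends dM)/(_ xy)/eqP; apply.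
by case/orP: xuv xy => /eqP->; case/orP: yuv yz => /eqP->; case/orP: zuv => /eqP->;
  rewrite ?eqxx.
Qed.

(* [cnt] acts on cocycles as zero in cohomology, so that modulo coboundaries [i`! * f]
   is the product of [f] with [(1 - cnt) ... (i - cnt)], which vanishes wherever
   [0 < cnt <= i]. *)
Lemma factorial_exact f k : (forall s, nd s -> size s = k.+2 -> delta d f s = 0) ->
  forall i, exists chi, forall s, nd s -> size s = k.+1 ->
  i`!%:Z * f s = (\prod_(j < i) (j.+1%:Z - (cnt s)%:Z)) * f s + delta d chi s.
Proof.
move=> fZ i; pose F i s := (\prod_(j < i) (j.+1%:Z - (cnt s)%:Z)) * f s.
suff [] : (forall s, nd s -> size s = k.+2 -> delta d (F i) s = 0) /\
    exists chi, forall s, nd s -> size s = k.+1 -> i`!%:Z * f s = F i s + delta d chi s by [].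
elim: i => [|i [FZ [chi chiP]]].
  split=> [s nds ss|].
    by rewrite -(fZ s) //; apply: eq_delta => t; rewrite /F big_ord0 mul1r.
  by exists (fun=> 0) => s _ _; rewrite delta0 addr0 /F big_ord0.
have insF s : nd s -> size s = k.+1 -> delta d (ins (F i)) s = (cnt s)%:Z * F i s.
  move=> nds ss; rewrite -ins_homotopy // (_ : ins (delta d (F i)) s = 0) ?addr0 //.
  (* Neither end of a gap is [u], so the enlarged tuple is non-degenerate and the cocycle condition
     applies to it. *)
  rewrite (ins_ext (f' := fun=> 0 * 0)) ?ins_scale ?mul0r // => p x y q sE gxy.
  apply: FZ; last by rewrite size_cat /= -ss sE size_cat /=; lia.
  move: nds; rewrite sE {sE ss}; have [xu uy] : x != u /\ u != y.
    have uv : u != v by rewrite eq_sym.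
    by case/orP: gxy => /and3P[/eqP-> ? ?]; rewrite ?vu ?uv // eq_sym.
  rewrite /nd; elim: p => [|w p IH] /=; first by rewrite xu uy => /andP[_ ->].
  by case: p IH => [|w' p] IH /= /andP[-> /IH].
have FS s : F i.+1 s = i.+1%:Z * F i s - (cnt s)%:Z * F i s.
  by rewrite /F big_ord_recr /=; ring.
split=> [s nds ss|].
  rewrite (@delta_nd _ _ dM _ (fun s => i.+1%:Z * F i s - delta d (ins (F i)) s)) //.
    by rewrite deltaB deltaZ FZ // (delta_delta (dist_tri dM)) mulr0 subrr.
  by move=> t ndt; rewrite ss => -[st]; rewrite FS insF.
exists (fun s => i.+1%:Z * chi s - -1 * ins (F i) s) => s nds ss.
rewrite deltaB !deltaZ insF // FS factS PoszM -mulrA chiP //; ring.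
Qed.

(** By [cnt_le] the product in [factorial_exact] has a zero factor whenever [cnt s] is positive. If
    [cnt s = 0], the tuple alternates, so [n * f s = 0] and [f s] vanishes. *)
Lemma leaf_exact f psi (n : int) k : n != 0 ->
  (forall s, nd s -> size s = k.+2 -> delta d f s = 0) ->
  (forall s, nd s -> size s = k.+1 -> n * f s = delta d psi s) ->
  exists chi, forall s, nd s -> size s = k.+1 -> v \in s ->
  (2 * k.+1)`!%:Z * f s = delta d chi s.
Proof.
move=> n0 fZ fT; have [chi chiP] := factorial_exact fZ (2 * k.+1); exists chi => s nds ss vs.
rewrite chiP //; case: (posnP (cnt s)) => [c0|c0].
  suff -> : f s = 0 by rewrite mulr0 add0r.
  apply/eqP; have := fT s nds ss; rewrite delta_alternating ?cnt0_alternating //.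
  by move/eqP; rewrite mulf_eq0 (negPf n0).
have ci : ((cnt s).-1 < 2 * k.+1)%N.
  by have := cnt_le s; rewrite ss; lia.
by rewrite (bigD1 (Ordinal ci)) //= prednK // subrr !mul0r add0r.
Qed.

(** A leaf is between no two other vertices, so tuples through [v] and tuples avoiding it do not
    interact. *)
Lemma mem_del p x y z q : nd (p ++ [:: x, y, z & q]) -> btw d x y z ->
  (v \in p ++ [:: x, z & q]) = (v \in p ++ [:: x, y, z & q]).
Proof.
move=> /nd_cat; rewrite !nd_cons2 => /and3P[xy yz _] b; rewrite !mem_cat !inE.
suff /negPf-> : v != y by [].
apply/eqP => vy; rewrite -vy in xy yz b; move: b; apply/negP.
by apply: leaf_not_between; rewrite // eq_sym.
Qed.

Let T' := {x : T | x != v}.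
Let d' (x y : T') := d (val x) (val y).

Lemma delta_map f (s : seq T') : delta d f (map val s) = delta d' (fun t => f (map val t)) s.
Proof.
elim: s f => [|x [|y [|z s]] IH] f //.
by rewrite [map _ _]/= !deltaE; congr (_ - _); apply: (IH (fun t => f (val x :: t))).
Qed.

Lemma nd_map (s : seq T') : nd (map val s) = nd s.
Proof.
by rewrite /nd sorted_map; apply: eq_sorted => x y /=; rewrite (inj_eq val_inj).
Qed.

(** The primitive is chosen separately on the two kinds of tuples: from [leaf_exact] on those
    through [v], from the smaller metric on the others. *)
Lemma magnitude_torsion_leaf k m : ((2 * k.+1)`! %| m)%N ->
  magnitude_torsion d' k m -> magnitude_torsion d k m.
Proof.
move=> /dvdnP[q ->] T'P f psi n n0 fZ fT.
have [chi chiP] := leaf_exact n0 fZ fT.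
pose up f (t : seq T') : int := f (map val t).
have [||psi' psi'P] := T'P (up f) (up psi) n n0.
- by move=> s nds ss; rewrite -delta_map fZ ?nd_map ?size_map.
- by move=> s nds ss; rewrite -delta_map -fT ?nd_map ?size_map.
exists (fun s => if v \in s then q%:Z * chi s else psi' (pmap insub s)) => s nds ss.
case: (boolP (v \in s)) => vs.
  rewrite PoszM -mulrA chiP // -deltaZ; apply: delta_ext => p x y z r sE b.
  by rewrite (mem_del _ b) -sE ?nds // vs.
rewrite (delta_ext (f' := fun t => psi' (pmap insub t))) => [|p x y z r sE b]; last first.
  by rewrite (mem_del _ b) -sE ?nds // (negPf vs).
have [s' sE] : exists s' : seq T', s = map val s'.
  exists (pmap insub s); rewrite -[LHS]map_id.
  elim: s vs {nds ss} => //= x s IH; rewrite inE negb_or eq_sym => /andP[xv vs].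
  by rewrite insubT /= {1}IH.
move: nds ss; rewrite sE nd_map size_map => nds ss.
rewrite delta_map [LHS](psi'P s' nds ss); apply: eq_delta => t.
by congr psi'; elim: t => //= x t {1}->; rewrite valK.
Qed.

End Leaf.

(** * Removing a leaf from a graph *)

Section GraphLeaf.
Variables (g : nat) (T : finType) (d : T -> T -> nat) (v u : T).
Hypothesis gd : graph_metric g d.
Hypothesis nv : nbr d v = [set u].

Lemma leaf_dist x : x != v -> d v x = (d u x).+1.
Proof.
rewrite eq_sym => /(gm_geodesic gd)[y vy ->]; congr (d _ _).+1.
by apply/eqP; rewrite -in_set1 -nv inE vy.
Qed.

Lemma leaf_neq : v != u.
Proof.
apply/eqP => vu; have : u \in nbr d v by rewrite nv set11.
by rewrite inE -vu (dist_xx gd).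
Qed.

(** Geodesics between other vertices avoid [v]. The degree sum drops by 2, once at [v] and once at
    [u], and the vertex count by 1, so the genus inequality persists. *)
Lemma graph_metric_leaf :
  graph_metric g (fun x y : {x : T | x != v} => d (val x) (val y)).
Proof.
have dS := dist_sym gd; split.
- split=> [x y|x y|x y z]; [by rewrite (dist_eq0 gd)|exact: dS|exact: dist_tri gd _ _ _].
- move=> x c xc; have [y xy yc] := gm_geodesic gd (xc : val x != val c).
  have yv : y != v.
    apply/eqP => yv; move: yc; rewrite yv leaf_dist ?(valP c) //.
    suff -> : val x = u by lia.
    by apply/eqP; rewrite -in_set1 -nv inE dS; move: xy; rewrite yv => ->.
  by exists (exist _ y yv).
have deg1 : (\sum_y (d v y == 1%N) = 1)%N by rewrite -card_sum -/(nbr d v) nv cards1.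
have := gm_genus gd; rewrite (bigD1 v) //= nv cards1.
have -> : (\sum_(x | x != v) #|nbr d x| =
    1 + \sum_(x : {x : T | x != v}) #|nbr (fun x y : {x : T | x != v} => d (val x) (val y)) x|)%N.
  rewrite (eq_bigr (fun x => (d x v == 1) + \sum_(y | y != v) (d x y == 1))%N); last first.
    by move=> x _; rewrite card_sum (bigD1 v).
  rewrite big_split /=; congr (_ + _)%N.
    rewrite -[RHS]deg1 [RHS](bigD1 v) //= (dist_xx gd) add0n.
    by apply: eq_bigr => x _; rewrite dS.
  rewrite [LHS](big_sub (fun x => x != v)); apply: eq_bigr => x _.
  by rewrite card_sum [LHS](big_sub (fun x => x != v)).
have -> : #|T| = #|{: {x : T | x != v}}|.+1.
  rewrite card_sig -[LHS]cardsT (cardsD1 v) inE; congr _.+1.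
  by apply: eq_card => x; rewrite !inE andbT.
by move: (bigop _ _ _) #|_| => a b; lia.
Qed.

End GraphLeaf.

Lemma magnitude_torsion_mulr (T : eqType) (d : T -> T -> nat) k m q :
  magnitude_torsion d k m -> magnitude_torsion d k (q * m).
Proof.
move=> mP f psi n n0 fZ fT; have [psi' psi'P] := mP f psi n n0 fZ fT.
by exists (fun t => q%:Z * psi' t) => s nds ss; rewrite deltaZ -psi'P // PoszM mulrA.
Qed.

(** Pruning only requires the factorial to divide the constant, which therefore does not grow with
    the number of leaves removed. *)
Lemma magnitude_torsion_graph g k : exists2 m, (0 < m)%N &
  forall (T : finType) (d : T -> T -> nat), graph_metric g d -> magnitude_torsion d k m.
Proof.
case: k => [|[|k]].
(* Tuples of at most two vertices have no inner vertex, so [n * f = 0] and [f] vanishes. *)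
1,2: exists 1%N => // T d gd f psi n n0 fZ fT; exists psi => s nds ss;
  have := fT s nds ss; rewrite delta_short ?ss // => /eqP;
  by rewrite mulf_eq0 (negPf n0) => /eqP->; rewrite mulr0.
have [m m0 mP] := magnitude_torsion_core g k.
exists ((2 * k.+3)`! * m)%N; first by rewrite muln_gt0 fact_gt0.
move=> T d; have [N] := ubnP #|T|; elim: N => // N IH in T d * => TN gd.
case: (pickP (fun v => #|nbr d v| == 1%N)) => [v /cards1P[u nv]|deg1].
  apply: (magnitude_torsion_leaf gd (leaf_neq gd nv) (leaf_dist gd nv)).
    by rewrite dvdn_mulr.
  apply: IH (graph_metric_leaf gd nv).
  rewrite card_sig -ltnS; apply: leq_trans TN; rewrite ltnS.
  by apply/proper_card/properP; split; [apply/subsetP | exists v; rewrite ?inE ?eqxx].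
apply: magnitude_torsion_mulr.
(* A vertex without neighbours is the whole graph, which has no non-degenerate tuple of length two
   or more. *)
case: (pickP (fun v => #|nbr d v| == 0%N)) => [v /eqP/cards0_eq nv|deg0].
  have all_v x : x = v.
    apply/eqP; apply: contraT; rewrite eq_sym => /(gm_geodesic gd)[y vy _].
    have : y \in nbr d v by rewrite inE vy.
    by rewrite nv inE.
  move=> f psi n n0 fZ fT; exists psi => -[|x [|y s]] //.
  by rewrite nd_cons2 (all_v x) (all_v y) eqxx.
apply: mP => // x; have := deg1 x; have := deg0 x; lia.
Qed.

(** * Magnitude cohomology of graphs *)

Section GraphDist.
Variable G : graph.
Local Notation adj := (adjacent (@ends G)).

Lemma dist_path u p : path adj u p -> (dist u (last u p) <= size p)%N.
Proof.
move=> up; rewrite /dist; case: ex_minnP => n _; apply; apply/existsP.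
by exists (in_tuple p); rewrite up eqxx.
Qed.

Lemma dist_pathP (u v : vertex G) : exists p, [/\ path adj u p, last u p = v & size p = dist u v].
Proof.
rewrite /dist; case: ex_minnP => n /existsP[p /andP[up /eqP pv]] _.
by exists p; rewrite size_tuple.
Qed.

Lemma adjacent_sym : symmetric adj.
Proof. by move=> x y; apply: eq_existsb => e; rewrite orbC. Qed.

Lemma dist1 (x y : vertex G) : dist x y = 1%N -> adj x y /\ x != y.
Proof.
have [[|z [|? ?]] [/= xz zy sp]] := dist_pathP x y; rewrite -sp // => _.
move: xz; rewrite andbT zy => xz; split=> //.
by apply/eqP => xy; have := @dist_path x [::] isT; rewrite /= {2}xy -sp.
Qed.

Lemma dist_metric : metric (@dist G).
Proof.
have d_le (x y : vertex G) : (dist x y <= dist y x)%N.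
  have [p [yp pE <-]] := dist_pathP y x.
  have lastE : last (last y p) (rev (belast y p)) = y.
    by case: (p) => //= a q; rewrite rev_cons last_rcons.
  have := @dist_path (last y p) (rev (belast y p)).
  rewrite rev_path lastE size_rev size_belast pE; apply.
  by rewrite (eq_path (e' := adj)) // => a b; apply: adjacent_sym.
split=> [x y|x y|x y z].
- apply/idP/eqP => [/eqP d0|->].
    by have [p [_ + /eqP]] := dist_pathP x y; rewrite d0 size_eq0 => + /eqP pE; rewrite pE.
  by have := @dist_path y [::] isT; rewrite leqn0.
- by apply/eqP; rewrite eqn_leq !d_le.
have [p [xp <- <-]] := dist_pathP x y; have [q [yq <- <-]] := dist_pathP (last x p) z.
by rewrite -last_cat -size_cat dist_path // cat_path xp.
Qed.

Lemma dist_graph_metric g : genus G <= g%:Z -> graph_metric g (@dist G).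
Proof.
move=> genG; split; first exact: dist_metric.
  move=> x c xc; have dM := dist_metric.
  have [[|y p] [/= xp pc sp]] := dist_pathP x c; first by rewrite pc eqxx in xc.
  have /andP[xy yp] := xp; have := dist_path yp; rewrite pc => yc.
  have xy1 : (dist x y <= 1)%N by apply: (@dist_path x [:: y]); rewrite /= xy.
  by have := dist_tri dM x y c; exists y; lia.
have card_le : (\sum_x #|nbr (@dist G) x| <= 2 * #|edge G|)%N.
  have -> : (\sum_x #|nbr (@dist G) x| =
      #|[set p : vertex G * vertex G | dist p.1 p.2 == 1%N]|)%N.
    rewrite card_sum; under eq_bigr => x _ do rewrite card_sum.
    by rewrite pair_bigA.
  pose sw (p : vertex G * vertex G) := (p.2, p.1).
  (* Each edge accounts for at most two ordered pairs at distance one; loops account for none and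
     parallel edges share theirs. *)
  apply: leq_trans (_ : #|(@ends G @: setT) :|: ((sw \o @ends G) @: setT)| <= _)%N.
    apply/subset_leq_card/subsetP => -[x y]; rewrite !inE => /eqP/dist1[/existsP[e]].
    case/orP => /eqP eE _; apply/orP; [left|right]; apply/imsetP; exists e => //.
    by rewrite /= eE.
  rewrite mul2n -addnn; apply: leq_trans (leq_card_setU _ _) _.
  by rewrite leq_add // -cardsT leq_imset_card.
move: genG card_le; rewrite /genus; move: (bigop _ _ _) #|edge G| #|vertex G| => a b c; lia.
Qed.

End GraphDist.

(** * Comparison with the magnitude complex *)

Section Removal.
Variables (T : eqType) (d : T -> T -> nat).

Fixpoint slen (s : seq T) : nat :=
  if s is x :: s1 then (if s1 is y :: _ then d x y else 0) + slen s1 else 0.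

Definition del_at i (s : seq T) := take i s ++ drop i.+1 s.

Lemma slen_btw p x y z q :
  btw d x y z -> slen (p ++ [:: x, z & q]) = slen (p ++ [:: x, y, z & q]).
Proof.
move=> /eqP b; elim: p => [|w p IH] /=; first by rewrite -b -addnA.
by rewrite IH; case: (p).
Qed.

(** A deletion changes only the distances next to the deleted vertex, so preserving the length is
    the condition [btw]. *)
Lemma delta_del_at f s : (1 < size s)%N -> delta d f s =
  - \sum_(1 <= i < (size s).-1) (-1) ^+ i * ((slen (del_at i s) == slen s)%:R * f (del_at i s)).
Proof.
elim: s f => [|x [|y [|z s]] IH] f // _; first by rewrite big_geq ?oppr0.
rewrite deltaE IH // [X in _ = - X]big_nat_recl // expr1 mulN1r opprD opprK opprK.
congr (_ * _ + _).
  by rewrite /del_at /btw /=; congr ((nat_of_bool _)%:R); lia.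
rewrite -sumrN; apply: eq_big_nat => i /andP[i0 _].
rewrite exprS mulN1r mulNr opprK; case: i i0 => // i _.
by rewrite /del_at /= eqn_add2l.
Qed.

End Removal.

Section Bridge.
Variable G : graph.
Local Notation V := (vertex G).
Local Notation d := (@dist G).

Lemma slen_nth x0 (s : seq V) :
  slen d s = (\sum_(i < (size s).-1) d (nth x0 s i) (nth x0 s i.+1))%N.
Proof.
elim: s => [|x [|y s] IH]; rewrite ?big_ord0 //.
by rewrite big_ord_recl /=; congr (_ + _)%N; apply: IH.
Qed.

Lemma generatorE k l (t : k.+1.-tuple V) : generator l t = nd t && (slen d t == l).
Proof.
have -> : slen d t = tlength t.
  rewrite (slen_nth (thead t)) size_tuple; apply: eq_bigr => i _.
  by rewrite !(tnth_nth (thead t)).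
rewrite /generator; congr andb.
apply/forallP/(sortedP (thead t)) => H i; last first.
  by rewrite !(tnth_nth (thead t)) /=; apply: H; rewrite size_tuple ltnS.
rewrite size_tuple ltnS => ik; have := H (Ordinal ik).
by rewrite !(tnth_nth (thead t)).
Qed.

Lemma delE k (i : 'I_k.+2) (t : k.+2.-tuple V) : del i t = del_at i t :> seq V.
Proof.
have si : (i < size t)%N by rewrite size_tuple.
apply: (@eq_from_nth _ (thead t)) => [|j].
  by rewrite size_tuple size_cat size_takel ?(ltnW si) // size_drop size_tuple; have := ltn_ord i; lia.
rewrite size_tuple => jk; rewrite (nth_mktuple _ _ (Ordinal jk)) (tnth_nth (thead t)) /=.
rewrite nth_cat size_takel ?(ltnW si) // /bump.
case: (ltnP j i) => [ji|ij]; first by rewrite nth_take // leqNgt ji.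
by rewrite nth_drop; congr nth; lia.
Qed.

(** Extension by zero to all sequences; the two [insub] test the number of vertices and then the
    generator condition. *)
Definition eval k l (phi : coMC G int k l) (s : seq V) : int :=
  if insub s is Some t then
    if insub (t : k.+1.-tuple V) is Some v then phi (mc_basis int (v : mtuple G k l)) else 0
  else 0.

Lemma eval_mtuple k l (phi : coMC G int k l) (v : mtuple G k l) :
  eval phi (val (val v)) = phi (mc_basis int v).
Proof. by rewrite /eval !valK. Qed.

Lemma eval_out k l (phi : coMC G int k l) s :
  ~~ [&& size s == k.+1, nd s & slen d s == l] -> eval phi s = 0.
Proof.
rewrite /eval; case: insubP => //= t _ <-; rewrite size_tuple eqxx /=.
by case: insubP => //= v; rewrite generatorE => ->.
Qed.

Lemma evalP k l (s : seq V) : [&& size s == k.+1, nd s & slen d s == l] ->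
  exists v : mtuple G k l, s = val (val v).
Proof.
case/and3P => sk nds sl.
have gs : generator l (Tuple sk) by rewrite generatorE nds.
by exists (exist _ (Tuple sk) gs).
Qed.

Lemma delta_eval k l (phi : coMC G int k l) s : nd s -> size s = k.+2 ->
  delta d (eval phi) s = - eval (coboundary phi) s.
Proof.
move=> nds ss; case: (eqVneq (slen d s) l) => [sl|sl]; last first.
  rewrite eval_out ?nds ?(negPf sl) ?andbF // oppr0 (delta_ext (f' := fun=> 0)) ?delta0 //.
  move=> p x y z q sE b; rewrite eval_out // (slen_btw _ _ b) -sE (negPf sl).
  by rewrite !andbF.
have [|v sE] := @evalP k.+1 l s; first by rewrite nds ss sl !eqxx.
rewrite sE eval_mtuple -sE delta_del_at ?ss //; congr (- _).
rewrite /coboundary comp_lfunE /boundary lfunE /= /boundary_fun (bigD1 v) //=.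
rewrite [X in _ + X]big1 ?addr0 => [|w wv]; last by rewrite ffunE (negPf wv) scale0r.
rewrite ffunE eqxx scale1r linear_sum.
rewrite (eq_bigr (fun i : 'I_k.+2 => (-1) ^+ i * eval phi (del_at i s))); last first.
  move=> i _; rewrite linearZ /=; congr (_ * _).
  by rewrite sE /face -delE /eval valK; case: insubP => [w _ _|_] //=; rewrite linear0.
rewrite (big_nat_widen _ _ k.+2) // (big_nat_widenl 1 0) // big_mkord.
apply: eq_big => [i|i /andP[i1 ik]]; first by rewrite andbC.
congr (_ * _); case: eqP => [_|sli]; first by rewrite mul1r.
by rewrite eval_out ?mulr0 // -sl; apply/negP => /and3P[_ _ /eqP].
Qed.

Definition of_fun_fun k l (psi : seq V -> int) (c : MC G int k l) : int^o :=
  \sum_(v : mtuple G k l) (c : {ffun mtuple G k l -> int^o}) v * psi (val (val v)).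

Lemma of_fun_is_linear k l psi : linear (@of_fun_fun k l psi).
Proof.
move=> a c c'; rewrite /of_fun_fun scaler_sumr -big_split /=; apply: eq_bigr => v _.
by rewrite !ffunE /= mulrDl scalerAl.
Qed.

HB.instance Definition _ k l psi := GRing.isLinear.Build int (MC G int k l) int^o _
  (@of_fun_fun k l psi) (@of_fun_is_linear k l psi).

Definition of_fun k l psi : coMC G int k l := linfun (@of_fun_fun k l psi).

Lemma of_fun_basis k l psi (v : mtuple G k l) : of_fun k l psi (mc_basis int v) = psi (val (val v)).
Proof.
rewrite /of_fun lfunE /= /of_fun_fun (bigD1 v) //= big1 => [|w wv]; rewrite ffunE.
  by rewrite eqxx mul1r addr0.
by rewrite (negPf wv) mul0r.
Qed.

Lemma eq_coMC k l (phi phi' : coMC G int k l) :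
  (forall v, phi (mc_basis int v) = phi' (mc_basis int v)) -> phi = phi'.
Proof.
move=> E; apply/lfunP => c.
have -> : c = \sum_v (c : {ffun mtuple G k l -> int^o}) v *: mc_basis int v.
  apply/ffunP => w; rewrite sum_ffunE (bigD1 w) //= big1 => [|v vw]; rewrite !ffunE.
    by rewrite eqxx /= addr0; exact: esym (mulr1 _).
  by rewrite eq_sym (negPf vw); exact: mulr0.
by rewrite !linear_sum; apply: eq_bigr => v _; rewrite !linearZ /= E.
Qed.

Lemma coMC_mulrz k l (phi : coMC G int k l) n c : (phi *~ n) c = n * phi c.
Proof. by rewrite -scaler_int intz scale_lfunE. Qed.

Lemma coMC0 k l c : (0 : coMC G int k l) c = 0.
Proof. by have := coMC_mulrz (0 : coMC G int k l) 0 c; rewrite mulr0z mul0r. Qed.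

Lemma eval_mulrz k l (phi : coMC G int k l) n s : eval (phi *~ n) s = n * eval phi s.
Proof.
rewrite /eval; case: insub => [t|]; last by rewrite mulr0.
by case: insub => [v|]; rewrite ?mulr0 // coMC_mulrz.
Qed.

Lemma coboundary_torsion k l m (phi : coMC G int k l) n a :
  magnitude_torsion d k m -> n != 0 -> coboundary phi = 0 ->
  coboundary_in G int k l a = phi *~ n ->
  exists a', coboundary_in G int k l a' = phi *~ m%:Z.
Proof.
case: k phi a => [|k] phi a mP n0 phi0 aE.
  (* In degree 0 the incoming differential is zero, so [phi] is annihilated by [n] and vanishes. *)
  exists 0; rewrite -[LHS]/(0 : coMC G int 0 l); apply: eq_coMC => v.
  have /eqP : (phi *~ n) (mc_basis int v) = 0 by rewrite -aE -[coboundary_in _ _ _ _ _]/(0 : coMC G int 0 l) coMC0.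
  rewrite !coMC_mulrz coMC0 mulf_eq0 (negPf n0) => /eqP->.
  by rewrite mulr0.
(* The factor [-1] compensates the sign between [delta] and [coboundary]. *)
have [s nds ss|s nds ss|psi psiP] := mP (eval phi) (fun s => -1 * eval a s) n n0.
- by rewrite delta_eval // phi0 /eval; case: insub => [t|]; rewrite ?oppr0 //;
    case: insub => [v|]; rewrite ?coMC0 oppr0.
- by rewrite deltaZ delta_eval // aE eval_mulrz mulN1r opprK.
exists (of_fun k l (fun s => -1 * psi s)); apply: eq_coMC => v.
rewrite -!eval_mtuple eval_mulrz.
have : generator l (val v) by apply: (valP v).
rewrite generatorE => /andP[nds /eqP sl]; have ss : size (val (val v)) = k.+2 by rewrite size_tuple.
rewrite psiP // -[LHS]opprK -delta_eval //.
rewrite (delta_ext (f' := fun s => -1 * psi s)).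
  by rewrite deltaZ mulN1r opprK.
move=> p x y z q sE b; have [|w ->] := @evalP k l (p ++ [:: x, z & q]); last first.
  by rewrite eval_mtuple of_fun_basis.
rewrite (slen_btw _ _ b) -sE sl eqxx andbT; apply/andP; split.
  by move: ss; rewrite sE !size_cat /= !addnS => -[->].
by move: nds; rewrite sE => nds; apply: (nd_del (@dist_metric G) nds b).
Qed.

End Bridge.

(** * Classes and direct sums *)

Section CohomologyClasses.
Local Open Scope quotient_scope.
Variables (A B C : zmodType) (f : {additive A -> B}) (h : {additive B -> C}).

(** One representative serves every [n], so the torsion hypothesis and the conclusion concern the
    same cocycle. *)
Lemma cohomology_class (x : cohomology f h) : exists z : cocycles h, forall n,
  x *~ n = 0 <-> exists a, f a = val z *~ n.
Proof.
exists (repr x) => n.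
have -> : x *~ n = \pi_(cohomology f h) (repr x *~ n).
  by rewrite raddfMz /= reprK.
have E : (\pi_(cohomology f h) (repr x *~ n) == 0) = (repr x *~ n \in coboundaries f (g := h)).
  rewrite -[in RHS](subr0 (repr x *~ n)) Quotient.idealrBE.
  by rewrite -[0 in LHS](raddf0 \pi_(cohomology f h)).
rewrite -(raddfMz (val : cocycles h -> B)) /=; split.
  by move/eqP; rewrite E => /asboolP.
by move=> ?; apply/eqP; rewrite E; apply/asboolP.
Qed.

End CohomologyClasses.

Lemma dprod_mulrz (M : nat -> zmodType) (x : dprod M) n l : (x *~ n) l = x l *~ n.
Proof.
have nat_case (y : dprod M) j : (y *+ j) l = y l *+ j.
  by elim: j => [|j IH]; rewrite ?mulr0n // !mulrS -IH.
by case: n => n; rewrite ?NegzE ?mulrNz -!pmulrn -?nat_case.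
Qed.

Theorem theorem1 (k g : nat) :
  exists m : int, m != 0 /\
    forall G : graph, genus G <= g%:Z ->
      forall x : MHtotal G int k, torsion x -> x *~ m = 0.
Proof.
have [m m0 mP] := magnitude_torsion_graph g k.
exists m%:Z; split=> [|G genG x [n [n0 xn]]]; first by case: m m0 {mP}.
have valMz (y : MHtotal G int k) j l : val (y *~ j) l = val y l *~ j.
  by rewrite raddfMz dprod_mulrz.
(* The constant does not depend on [l], so the components of the direct sum can be treated one at a
   time. *)
apply: val_inj; apply: functional_extensionality_dep => l.
rewrite valMz; have xln : val x l *~ n = 0 by rewrite -valMz xn.
have [z zP] := cohomology_class (val x l).
have [a az] := (zP n).1 xln; apply/zP.
apply: (coboundary_torsion (mP _ _ (dist_graph_metric genG)) n0 _ az).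
by have := cocycleP z; rewrite unfold_in => /eqP.
Qed.
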